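(* Let $H$ be a complex Hilbert space and let $\phi: S(H)\to S(H)$ be a bijective map (not assumed to be linear or affine in any sense) which preserves the distance $d_1$, that is, $d_1(\phi(A),\phi(B))=d_1(A,B)$ for all $A,B\in S(H)$. Then there is an either unitary or antiunitary operator $U$ on $H$ such that $$\phi(A)=UAU^*\qquad (A\in S(H)).$$
   Context: $H$ is a complex Hilbert space (of arbitrary dimension). $C_1(H)$ denotes the set of all trace-class operators on $H$, i.e. bounded linear operators whose absolute value has finite trace, and $\operatorname{tr}$ is the trace functional. $S(H)$ is the set of all positive (i.e. positive semidefinite) operators $A\in C_1(H)$ with $\operatorname{tr}A=1$ (the normal states). The trace-norm of $A\in C_1(H)$ is $\|A\|_1=\operatorname{tr}|A|$, where $|A|$ is the absolute value of $A$, and $d_1(A,B)=\|A-B\|_1$. An antiunitary operator on $H$ is a conjugate-linear bijection $U:H\to H$ with $\langle Ux,Uy\rangle=\overline{\langle x,y\rangle}$ for all $x,y\in H$; its adjoint is $U^*=U^{-1}$ (as for unitary operators). *)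

(* Defs.v *)
From HB Require Import structures.
From mathcomp Require Import all_boot all_order all_algebra.
From mathcomp Require Import sesquilinear complex.
From mathcomp Require Import boolp classical_sets functions.
From mathcomp Require Import reals ereal topology normedtype esum.

Set Implicit Arguments.
Unset Strict Implicit.
Unset Printing Implicit Defensive.

Import Order.TTheory GRing.Theory Num.Theory Num.Def.
Import numFieldNormedType.Exports.

Local Open Scope classical_set_scope.
Local Open Scope complex_scope.
Local Open Scope ring_scope.

(* The norm is R[i]-valued (real and nonnegative for the order of R[i]).
   A form of type {dot H for _} is linear in its first argument and
   conjugate-linear in its second one. *)
HB.mixin Record CompleteNormedModule_isHilbert (R : realType) H
    of CompleteNormedModule R[i] H := {
  inner : {dot H for @conjC R[i]} ;
  inner_norm : forall x : H, inner x x = `|x| ^+ 2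
}.

#[short(type="hilbertType")]
HB.structure Definition Hilbert (R : realType) :=
  {H of CompleteNormedModule_isHilbert R H & CompleteNormedModule R[i] H}.

Section Operators.
Context {R : realType} {H : hilbertType R}.
Implicit Types (A B U V : H -> H) (E : set H).

Local Notation "''[' u , v ]" := (inner u v).

Definition bounded_op A : Prop :=
  linear A /\ exists M : R[i], forall x, `|A x| <= M * `|x|.

(* 0 <= z for z : R[i] means that z is real and nonnegative. *)
Definition positive_op A : Prop :=
  bounded_op A /\ forall x, 0 <= '[A x, x].

(* The adjoint of a bounded operator exists and is unique (Riesz); the default
   value of xget is only reached outside the bounded operators. *)
Definition adjoint A : H -> H :=
  xget (fun=> 0) [set B | forall x y, '[A x, y] = '[x, B y]].

(* |A|: the unique positive square root of A^* A. *)
Definition absop A : H -> H :=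
  xget (fun=> 0) [set B | positive_op B /\ B \o B = adjoint A \o A].

(* Orthonormal bases in the Hilbert space sense: orthonormal families whose
   orthogonal complement is trivial, without any cardinality restriction. *)
Definition orthonormal_basis E : Prop :=
  [/\ forall e, E e -> '[e, e] = 1,
      forall e f, E e -> E f -> e <> f -> '[e, f] = 0 &
      forall x, (forall e, E e -> '[x, e] = 0) -> x = 0].

(* Bases exist by Zorn's lemma. *)
Definition onb : set H := xget set0 [set E | orthonormal_basis E].

(* The trace of a positive operator, in [0, +oo]; it does not depend on the
   orthonormal basis. It is only used for positive operators, for which
   '[A e, e] is real. *)
Definition tr A : \bar R := \esum_(e in onb) (complex.Re '[A e, e])%:E.

Definition trace_class : set (H -> H) :=
  [set A | bounded_op A /\ (tr (absop A) < +oo)%E].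

Definition states : set (H -> H) :=
  [set A | [/\ positive_op A, trace_class A & tr A = 1%E]].

(* Finite on trace_class. *)
Definition trace_norm A : \bar R := tr (absop A).

Definition d1 A B : \bar R := trace_norm (A \- B).

Definition unitary U : Prop :=
  [/\ linear U, bijective U & forall x y, '[U x, U y] = '[x, y]].

Definition antiunitary U : Prop :=
  [/\ linear_for (@conjC R[i] \; *:%R) U, bijective U &
      forall x y, '[U x, U y] = conjC '[x, y]].

End Operators.

(* Main.v *)
Require Import Defs.
From HB Require Import structures.
From mathcomp Require Import all_boot all_order all_algebra.
From mathcomp Require Import sesquilinear complex.
From mathcomp Require Import boolp classical_sets functions.
From mathcomp Require Import reals ereal topology normedtype esum.
From mathcomp Require Import finmap cardinality fsbigop.
From mathcomp Require Import ring lra.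

Set Implicit Arguments.
Unset Strict Implicit.
Unset Printing Implicit Defensive.

Import Order.TTheory GRing.Theory Num.Theory.
Import numFieldNormedType.Exports.

Local Open Scope classical_set_scope.
Local Open Scope complex_scope.
Local Open Scope ring_scope.

(** For a unit vector [x] let [rk x] be the projection onto the line of [x],
    that is, a pure state. The proof reads the order structure of the states
    off the metric, by means of the following remark ([d1_rk], [d1_rk_le]):
    the difference [rk x - A] of a pure state and a state has at most one
    positive eigenvalue [l] and its trace is 0, so that [d1 (rk x) A = 2 l],
    where [l] is the least nonnegative number such that [rk x <= A + l] as
    quadratic forms ([rkle]).

    This has three consequences. First, a pure state [rk x] is at the maximal
    distance 2 from [A] exactly when [A x = 0] ([d1_rk2]); and a state at
    distance 2 from [A] vanishes on the eigenvectors of [A] with positive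
    eigenvalues ([d1_orth]). Hence the pure states are the states [A] such
    that [A] is the only state at distance 2 from all the states at distance 2
    from [A] ([rk_metric_pure], [metric_pure_rk]), and a bijective isometry
    permutes them ([phi_pure], [phi_pure_surj]). Second, for two pure states
    [l ^+ 2 = 1 - mod2 x y] ([d1_rk_rk]): transition probabilities are
    preserved, and Wigner's theorem ([wigner]) provides a unitary or antiunitary
    [U] that implements the isometry on the pure states. Third, a state is
    determined by its distances to the pure states ([rkle_determines]): if
    [A] and [B] have the same ones, consider the orthogonal complement of their
    common eigenvectors with common eigenvalues, and suppose that the largest
    eigenvalue [c] that [A] or [B] has there is positive, and is attained by [A],
    at [u]. Then [rk u <= A + (1 - c)], hence [rk u <= B + (1 - c)], and as the form
    of [B] is at most [c] there, [u] is an eigenvector of [B] as well, for the same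
    [c], which is absurd. Applying this to [A] and to the
    conjugate of [phi A] by [U] yields the theorem.

    The spectral theory rests on a single existence result, [top_eigenvector]:
    a compact self-adjoint operator that takes a positive value on an invariant
    closed subspace has there an eigenvector for its largest eigenvalue.
    Compactness is used in the form of an estimate on the quadratic form
    ([cptf]), which holds for positive operators of finite trace
    ([trace_cptf]). From it come the Jordan decomposition ([jordan]), the
    existence and the uniqueness of the absolute value of a difference of states
    ([absop_split], [sqrt_unique]), and the orthonormal bases of eigenvectors
    ([eigenbasis]), through which traces are computed ([eigen_esum],
    [trace_compress]). *)

(** * Real inner product *)
Section RealInner.
Context {R : realType} {H : hilbertType R}.
Implicit Types (x y z u v w : H) (a b c : R).

(** Spectral arguments and estimates need only the real part [rip] of the inner
    product, a symmetric bilinear form with values in [R]. Multiplication by the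
    imaginary unit, [J], gives the imaginary part back ([innerE]). *)
Definition rscale a x : H := (a%:C)%C *: x.
Definition J x : H := ('i%C : R[i]) *: x.
Definition rip x y : R := complex.Re (inner x y).
Definition sq x : R := rip x x.

Lemma rscaleDr a x y : rscale a (x + y) = rscale a x + rscale a y.
Proof. exact: scalerDr. Qed.
Lemma rscaleDl a b x : rscale (a + b) x = rscale a x + rscale b x.
Proof. by rewrite /rscale rmorphD scalerDl. Qed.
Lemma rscaleA a b x : rscale a (rscale b x) = rscale (a * b) x.
Proof. by rewrite /rscale rmorphM scalerA. Qed.
Lemma rscale1 x : rscale 1 x = x.
Proof. by rewrite /rscale rmorph1 scale1r. Qed.
Lemma rscaleN a x : rscale (- a) x = - rscale a x.
Proof. by rewrite /rscale rmorphN scaleNr. Qed.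
Lemma rscale0 a : rscale a 0 = 0.
Proof. exact: scaler0. Qed.
Lemma rscale0l x : rscale 0 x = 0.
Proof. by rewrite /rscale rmorph0 scale0r. Qed.

Lemma ripDl x y z : rip (x + y) z = rip x z + rip y z.
Proof. by rewrite /rip linearDl raddfD. Qed.
Lemma ripNl x z : rip (- x) z = - rip x z.
Proof. by rewrite /rip linearNl raddfN. Qed.
Lemma ripBl x y z : rip (x - y) z = rip x z - rip y z.
Proof. by rewrite ripDl ripNl. Qed.
Lemma innerC x y : inner x y = ((inner y x)^*)%C.
Proof. by rewrite (@hermC _ _ _ _ (@inner R H)) expr0 mul1r. Qed.
Lemma ripC x y : rip x y = rip y x.
Proof. by rewrite /rip innerC; case: (inner y x). Qed.
Lemma ripDr x y z : rip x (y + z) = rip x y + rip x z.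
Proof. by rewrite ripC ripDl ![rip _ x]ripC. Qed.
Lemma ripNr x z : rip x (- z) = - rip x z.
Proof. by rewrite ripC ripNl ripC. Qed.
Lemma ripBr x y z : rip x (y - z) = rip x y - rip x z.
Proof. by rewrite ripDr ripNr. Qed.
Lemma ripZl a x y : rip (rscale a x) y = a * rip x y.
Proof.
by rewrite /rip /rscale linearZl_LR /=; case: (inner x y) => p q /=; rewrite mul0r subr0.
Qed.
Lemma ripZr a x y : rip x (rscale a y) = a * rip x y.
Proof. by rewrite ripC ripZl ripC. Qed.
Lemma rip0l y : rip 0 y = 0.
Proof. by rewrite /rip linear0l. Qed.
Lemma rip0r y : rip y 0 = 0.
Proof. by rewrite ripC rip0l. Qed.

Lemma inner_sq x : inner x x = (sq x)%:C%C.
Proof.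
have : 0 <= inner x x by rewrite inner_norm exprn_ge0.
by rewrite /sq /rip; case: (inner x x) => p q; rewrite lecE /= => /andP[/eqP -> _].
Qed.
Lemma sq_ge0 x : 0 <= sq x.
Proof. by have : 0 <= inner x x; [rewrite inner_norm exprn_ge0|rewrite inner_sq ler0c]. Qed.
Lemma sq_eq0 x : sq x = 0 -> x = 0.
Proof.
move=> s0; have := inner_norm x; rewrite inner_sq s0 => /esym/eqP.
by rewrite expf_eq0 /= normr_eq0 => /eqP.
Qed.
Lemma norm_sq x : `|x| = (Num.sqrt (sq x))%:C%C.
Proof.
apply/eqP; rewrite -(@eqrXn2 _ 2) //; last by rewrite ler0c sqrtr_ge0.
by rewrite -inner_norm inner_sq -rmorphXn /= sqr_sqrtr ?sq_ge0.
Qed.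
Lemma sq0 : sq 0 = 0. Proof. exact: rip0l. Qed.
Lemma sqN x : sq (- x) = sq x. Proof. by rewrite /sq ripNl ripNr opprK. Qed.
Lemma sqD x y : sq (x + y) = sq x + 2 * rip x y + sq y.
Proof. rewrite /sq !(ripDl, ripDr) (ripC y x); ring. Qed.
Lemma sqB x y : sq (x - y) = sq x - 2 * rip x y + sq y.
Proof. rewrite /sq !(ripBl, ripBr) (ripC y x); ring. Qed.
Lemma sqZ a x : sq (rscale a x) = a ^+ 2 * sq x.
Proof. rewrite /sq ripZl ripZr; ring. Qed.
Lemma sqBC x y : sq (x - y) = sq (y - x).
Proof. by rewrite -opprB sqN. Qed.

Lemma cauchy_schwarz x y : rip x y ^+ 2 <= sq x * sq y.
Proof.
have [y0|] := eqVneq (sq y) 0.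
  by rewrite (sq_eq0 y0) rip0r sq0 mulr0 expr0n.
rewrite neq_lt ltNge sq_ge0 /= => y0.
have := sq_ge0 (rscale (sq y) x - rscale (rip x y) y).
rewrite sqB !sqZ ripZl ripZr => h.
by rewrite -subr_ge0 -(pmulr_rge0 _ y0); apply: le_trans h _; rewrite le_eqVlt; apply/orP; left; apply/eqP; ring.
Qed.

Lemma sqD_le x y : sq (x + y) <= 2 * sq x + 2 * sq y.
Proof. have := sq_ge0 (x - y); rewrite sqB sqD; lra. Qed.
Lemma sqB_le x y : sq (x - y) <= 2 * sq x + 2 * sq y.
Proof. by have := sqD_le x (- y); rewrite sqN. Qed.

Lemma innerE x y : inner x y = (rip x y +i* rip x (J y))%C.
Proof.
rewrite /rip /J linearZr_LR /=; case: (inner x y) => p q /=.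
by rewrite mul0r !mulN1r sub0r opprK.
Qed.
Lemma JJ x : J (J x) = - x.
Proof. by rewrite /J scalerA -expr2 sqr_i scaleN1r. Qed.
Lemma ripJl x y : rip (J x) y = - rip x (J y).
Proof.
rewrite /rip /J linearZl_LR linearZr_LR /=; case: (inner x y) => p q /=.
by rewrite !mul0r !mul1r mulN1r !sub0r opprK.
Qed.
Lemma ripJJ x y : rip (J x) (J y) = rip x y.
Proof. by rewrite ripJl JJ ripNr opprK. Qed.
Lemma sqJ x : sq (J x) = sq x. Proof. exact: ripJJ. Qed.
Lemma ripxJ x : rip x (J x) = 0.
Proof. have := ripJl x x; rewrite ripC; lra. Qed.
Lemma JD x y : J (x + y) = J x + J y. Proof. exact: scalerDr. Qed.
Lemma JZ a x : J (rscale a x) = rscale a (J x).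
Proof. by rewrite /J /rscale !scalerA mulrC. Qed.
Lemma scaleE (k : R[i]) x :
  k *: x = rscale (complex.Re k) x + rscale (complex.Im k) (J x).
Proof.
rewrite /rscale /J scalerA -scalerDl; congr (_ *: _).
by rewrite [in LHS](complexE k) (mulrC _ (complex.Im k)%:C).
Qed.

Lemma eq_rip x y : (forall z, rip x z = rip y z) -> x = y.
Proof.
by move=> h; apply/eqP; rewrite -subr_eq0; apply/eqP/sq_eq0; rewrite /sq ripBl h subrr.
Qed.

Lemma inner0 x y : (inner x y = 0) <-> (rip x y = 0 /\ rip x (J y) = 0).
Proof. by rewrite innerE; split=> [[-> ->]//|[-> ->]]. Qed.

(** The squared modulus of the complex inner product ([mod2E]). *)
Definition mod2 x y : R := rip x y ^+ 2 + rip x (J y) ^+ 2.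
Lemma mod2E x y : (mod2 x y)%:C%C = `|inner x y| ^+ 2.
Proof. by rewrite -add_Re2_Im2 innerE. Qed.
Lemma mod2_ge0 x y : 0 <= mod2 x y.
Proof. by rewrite addr_ge0 ?sqr_ge0. Qed.
Lemma mod2C x y : mod2 x y = mod2 y x.
Proof. by rewrite /mod2 (ripC x y) (ripC x (J y)) ripJl sqrrN. Qed.
Lemma mod2xx x : mod2 x x = sq x ^+ 2.
Proof. by rewrite /mod2 ripxJ expr0n addr0. Qed.
Lemma mod2_eq0 x y : mod2 x y = 0 <-> inner x y = 0.
Proof.
rewrite inner0 /mod2; split; last by move=> [-> ->]; rewrite expr0n addr0.
by move/eqP; rewrite paddr_eq0 ?sqr_ge0// !sqrf_eq0 => /andP[/eqP-> /eqP->].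
Qed.
End RealInner.

(** * Completeness, projections and top eigenvectors *)
Section Operators.
Context {R : realType} {H : hilbertType R}.
Implicit Types (x y z u v w : H) (T A B S : H -> H) (M : set H) (a b c e : R).

Lemma le0_eps a c : 0 <= c -> (forall e, 0 < e -> a <= e * c) -> a <= 0.
Proof.
move=> c0 h; rewrite leNgt; apply/negP => a0.
have c1 : 0 < c + 1 by lra.
have := h (a / (2 * (c + 1))) ltac:(by rewrite divr_gt0// mulr_gt0).
rewrite -mulrA.
have : (2 * (c + 1))^-1 * c <= 2^-1.
  by rewrite invfM -mulrA ler_piMr// ?invr_ge0// mulrC ler_pdivrMr//; lra.
set q := _ * c => q2; nra.
Qed.

Lemma sq_eq0_eps x c : 0 <= c -> (forall e, 0 < e -> sq x <= e * c) -> x = 0.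
Proof. by move=> c0 /(le0_eps c0) h; apply: sq_eq0; apply/eqP; rewrite eq_le h sq_ge0. Qed.

(** The norm of [H] takes its values in [R[i]]; this is completeness in terms of
    real tolerances. *)
Lemma hilbert_complete (G : set_system H) : ProperFilter G ->
  (forall e, 0 < e -> exists2 A : set H, G A & forall x y, A x -> A y -> sq (x - y) <= e) ->
  exists l, forall e, 0 < e -> G [set x | sq (x - l) <= e].
Proof.
have sqlt x e : 0 < e -> `|x| < e%:C%C -> sq x <= e ^+ 2.
  move=> e0; rewrite norm_sq ltcR => /ltW h.
  by rewrite -(sqr_sqrtr (sq_ge0 x)) ler_sqr ?nnegrE ?sqrtr_ge0 ?(ltW e0).
move=> PG cG.
have cauG : cauchy G.
  apply/cauchy_exP => /= eps eps0.
  have [e e0 ->] : exists2 e : R, 0 < e & eps = e%:C%C.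
    case: eps eps0 => p q; rewrite ltcE /= => /andP[/eqP -> p0]; by exists p.
  have e2 : 0 < (e / 2) ^+ 2 by rewrite exprn_gt0 ?divr_gt0.
  have [A GA hA] := cG _ e2.
  have [x Ax] := filter_ex GA.
  exists x; apply: filterS GA => y Ay; rewrite -ball_normE /ball_ /= norm_sq ltcR.
  rewrite -(ger0_norm (ltW e0)) -sqrtr_sqr ltr_sqrt ?exprn_gt0//.
  by apply: le_lt_trans (hA _ _ Ax Ay) _; rewrite ltr_sqr ?nnegrE; lra.
have [l Gl] : exists l : H, G --> l by apply/cvg_ex; exact: cauchy_cvg.
exists l => e e0.
have s0 : 0 < Num.sqrt e by rewrite sqrtr_gt0.
have sC : 0 < (Num.sqrt e)%:C%C by rewrite ltcR.
have := Gl _ (nbhsx_ballx l _ sC); apply: filterS => y.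
by rewrite -ball_normE /ball_ /= => /(sqlt _ _ s0); rewrite sqBC sqr_sqrtr // ltW.
Qed.

(** Closed complex subspaces. Closedness has the form in which limits are
    delivered by [hilbert_complete]. *)
Record closed_sub M : Prop := ClosedSub {
  csub0 : M 0;
  csubD : forall x y, M x -> M y -> M (x + y);
  csubZ : forall (k : R[i]) x, M x -> M (k *: x);
  csub_closed : forall x, (forall e, 0 < e -> exists2 y, M y & sq (x - y) <= e) -> M x }.

Lemma csubN M x : closed_sub M -> M x -> M (- x).
Proof. by move=> cM Mx; rewrite -scaleN1r; apply: csubZ. Qed.
Lemma csubB M x y : closed_sub M -> M x -> M y -> M (x - y).
Proof. by move=> cM Mx My; apply: csubD => //; apply: csubN. Qed.

(** By the parallelogram identity, the points of [M] that nearly realize the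
    distance from [x] to [M] form a Cauchy filter. Its limit [p] is the projection,
    since moving a near-minimizer along [m] cannot decrease the distance, which
    bounds the component of [x - p] along [m]. As [M] is a complex
    subspace, orthogonality for [rip] is orthogonality. *)
Lemma projection_theorem M x : closed_sub M ->
  exists2 p, M p & forall m, M m -> rip (x - p) m = 0.
Proof.
move=> cM.
pose E := [set sq (x - y) | y in M].
have hE : has_inf E.
  split; first by exists (sq (x - 0)), 0 => //; exact: csub0.
  by exists 0 => _ [y _ <-]; exact: sq_ge0.
pose d := inf E.
have dle y : M y -> d <= sq (x - y).
  by move=> My; apply: ge_inf; [case: hE|exists y].
pose B e := [set y | M y /\ sq (x - y) <= d + e].
have FB : ProperFilter (filter_from [set e : R | 0 < e] B).
  apply: filter_from_proper; first apply: filter_from_filter.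
  - by exists 1 => /=.
  - move=> i j /= i0 j0; exists (Num.min i j); first by rewrite lt_min i0.
    by move=> y [My ym]; split; split=> //; apply: le_trans ym _; rewrite lerD2l ge_min lexx ?orbT.
  - move=> e /= e0; have [_ [y My <-] yd] := inf_adherent e0 hE.
    by exists y; split=> //; exact: ltW.
have Bsmall e y z : B e y -> B e z -> sq (y - z) <= 4 * e.
  move=> [My hy] [Mz hz].
  have Mh : M (rscale 2^-1 (y + z)) by apply: csubZ => //; exact: csubD.
  have := dle _ Mh; rewrite sqB ripZr sqZ ripDr sqD.
  move: hy hz; rewrite !sqB; lra.
have [|l hl] := hilbert_complete FB.
  move=> e e0; exists (B (e / 4)); first by exists (e / 4) => //=; rewrite divr_gt0.
  by move=> y z hy hz; have := Bsmall _ _ _ hy hz; lra.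
exists l.
  apply: (csub_closed cM) => e e0.
  have [y [By yl]] : (B 1 `&` [set y | sq (y - l) <= e]) !=set0.
    by apply: (@filter_ex _ _ FB); apply: filterI; [exists 1 => /=|exact: hl].
  by exists y; [case: By|rewrite sqBC].
move=> m Mm.
suff : rip (x - l) m ^+ 2 <= 0.
  by move=> h; apply/eqP; rewrite -sqrf_eq0 eq_le h sqr_ge0.
apply: (@le0_eps _ (4 * sq m)); first by rewrite mulr_ge0 ?sq_ge0.
move=> e e0.
have [y [[My yd] /= yl]] : (B e `&` [set y | sq (y - l) <= e]) !=set0.
  by apply: (@filter_ex _ _ FB); apply: filterI; [exists e => /=|exact: hl].
have h1 : rip (x - y) m ^+ 2 <= e * sq m.
  have [m0|] := eqVneq (sq m) 0.
    by rewrite m0 (sq_eq0 m0) rip0r expr0n mulr0.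
  rewrite neq_lt ltNge sq_ge0 /= => m0.
  (* the displacement along m that decreases the distance most *)
  pose t := rip (x - y) m / sq m.
  have := dle (y + rscale t m) (csubD cM My (csubZ cM _ Mm)).
  rewrite opprD addrA sqB sqZ ripZr.
  have -> : 2 * (t * rip (x - y) m) = 2 * (rip (x - y) m ^+ 2 / sq m) by rewrite /t; ring.
  have -> : t ^+ 2 * sq m = rip (x - y) m ^+ 2 / sq m by rewrite /t; field; rewrite gt_eqF.
  rewrite -ler_pdivrMr//; lra.
have h2 : rip (y - l) m ^+ 2 <= e * sq m.
  by apply: le_trans (cauchy_schwarz _ _) _; rewrite ler_wpM2r ?sq_ge0.
have -> : x - l = (x - y) + (y - l) by rewrite addrA subrK.
rewrite ripDl.
have := sqr_ge0 (rip (x - y) m - rip (y - l) m).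
move: h1 h2; set p := rip _ m; set q := rip _ m; nra.
Qed.

(** Bounded self-adjoint operators. Symmetry for [rip] implies symmetry for the
    complex inner product because [T] commutes with [J] ([herm_inner]). *)
Record herm T : Prop := Herm {
  herm_lin : linear T;
  herm_bd : exists2 m, 0 < m & forall x, sq (T x) <= m * sq x;
  herm_sa : forall x y, rip (T x) y = rip x (T y) }.

Section Linear.
Variable T : H -> H.
Hypothesis lT : linear T.
Lemma linZ (k : R[i]) x : T (k *: x) = k *: T x.
Proof.
have := lT k x 0; have := lT 1 0 0; rewrite scale1r !addr0 scale1r.
by move/eqP; rewrite -subr_eq0 opprD addrA subrr sub0r oppr_eq0 => /eqP ->; rewrite addr0.
Qed.
Lemma lin0 : T 0 = 0.
Proof. by have := linZ 0 0; rewrite !scale0r. Qed.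
Lemma linD x y : T (x + y) = T x + T y.
Proof. by have := lT 1 x y; rewrite !scale1r. Qed.
Lemma linN x : T (- x) = - T x.
Proof. by rewrite -scaleN1r linZ scaleN1r. Qed.
Lemma linB x y : T (x - y) = T x - T y.
Proof. by rewrite linD linN. Qed.
Lemma linR a x : T (rscale a x) = rscale a (T x).
Proof. exact: linZ. Qed.
Lemma linJ x : T (J x) = J (T x).
Proof. exact: linZ. Qed.
End Linear.

Lemma herm_inner T x y : herm T -> inner (T x) y = inner x (T y).
Proof. by move=> hT; rewrite !innerE -(linJ (herm_lin hT)) !(herm_sa hT). Qed.

Definition qf T x : R := rip (T x) x.

Lemma qfD T x y : herm T -> qf T (x + y) = qf T x + 2 * rip (T x) y + qf T y.
Proof.
move=> hT; rewrite /qf (linD (herm_lin hT)) !(ripDl, ripDr) (ripC (T y)) -(herm_sa hT); ring.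
Qed.
Lemma qfB T x y : herm T -> qf T (x - y) = qf T x - 2 * rip (T x) y + qf T y.
Proof.
move=> hT; rewrite qfD// ripNr /qf (linN (herm_lin hT)) ripNr ripNl opprK; ring.
Qed.
Lemma qfZ T a x : herm T -> qf T (rscale a x) = a ^+ 2 * qf T x.
Proof. move=> hT; rewrite /qf (linR (herm_lin hT)) ripZl ripZr; ring. Qed.

Lemma hermZ a T : herm T -> herm (fun x => rscale a (T x)).
Proof.
move=> [lT [m m0 bT] sT]; split.
- by move=> k x y; rewrite lT /rscale scalerDr !scalerA mulrC.
- exists (a ^+ 2 * m + 1); first by rewrite ltr_wpDl// mulr_ge0 ?sqr_ge0// ltW.
  move=> x; rewrite sqZ; have := bT x; have := sqr_ge0 a; have := sq_ge0 x; nra.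
- by move=> x y; rewrite ripZl ripZr sT.
Qed.
Lemma hermD A B : herm A -> herm B -> herm (fun x => A x + B x).
Proof.
move=> [lT [m m0 bT] sT] [lB [n n0 bB] sB]; split.
- by move=> k x y; rewrite lT lB scalerDr addrACA.
- exists (2 * m + 2 * n); first lra.
  by move=> x; have := sqD_le (A x) (B x); have := bT x; have := bB x; nra.
- by move=> x y; rewrite ripDl ripDr sT sB.
Qed.
Lemma hermN T : herm T -> herm (fun x => - T x).
Proof. by move=> /(hermZ (-1)); congr herm; apply/funext => x; rewrite rscaleN rscale1. Qed.
Lemma hermB A B : herm A -> herm B -> herm (fun x => A x - B x).
Proof. by move=> hA /hermN; exact: hermD. Qed.
Lemma herm_id : herm id.
Proof. by split=> //; exists 1 => // x; rewrite mul1r. Qed.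

Lemma qf_bd T : herm T -> exists2 m, 0 < m & forall x, qf T x <= m * sq x.
Proof.
move=> [lT [m m0 bT] sT]; exists (m + 1); first lra.
move=> x; have := cauchy_schwarz (T x) x; have := bT x; rewrite /qf.
have := sqr_ge0 (rip (T x) x - sq x).
have := sq_ge0 x; set q := rip _ _; set s := sq x; set t := sq (T x) => s0 h1 h2 h3.
rewrite leNgt; apply/negP => h.
have : ((m + 1) * s) ^+ 2 < q ^+ 2 by rewrite ltr_sqr ?nnegrE; nra.
nra.
Qed.

(** The form is nonnegative at [x - T x / m]; expanding it there and bounding
    its value at [T x] by [m] gives the estimate. *)
Lemma psd_control T M m : herm T -> closed_sub M -> (forall x, M x -> M (T x)) ->
  0 < m -> (forall x, M x -> 0 <= qf T x) -> (forall x, M x -> qf T x <= m * sq x) ->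
  forall x, M x -> sq (T x) <= m * qf T x.
Proof.
move=> hT cM iM m0 pT bT x Mx.
have Mt : M (rscale m^-1 (T x)) by apply: csubZ => //; exact: iM.
have := pT _ (csubB cM Mx Mt); rewrite qfB// ripZr qfZ//.
have := bT _ (iM _ Mx); rewrite -/(sq _) => h1 h2.
have : m * (2 * (m^-1 * sq (T x)) - m^-1 ^+ 2 * qf T (T x)) <= m * qf T x by rewrite ler_pM2l//; lra.
have -> : m * (2 * (m^-1 * sq (T x)) - m^-1 ^+ 2 * qf T (T x)) =
   2 * sq (T x) - m^-1 * qf T (T x) by field; rewrite gt_eqF.
have : m^-1 * qf T (T x) <= sq (T x) by rewrite ler_pdivrMl.
lra.
Qed.

Lemma psd_eq0 T M : herm T -> closed_sub M -> (forall x, M x -> M (T x)) ->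
  (forall x, M x -> 0 <= qf T x) -> forall x, M x -> qf T x = 0 -> T x = 0.
Proof.
move=> hT cM iM pT x Mx x0; have [m m0 bT] := qf_bd hT.
have := psd_control hT cM iM m0 pT (fun y _ => bT y) Mx.
by rewrite x0 mulr0 => h; apply: sq_eq0; apply/eqP; rewrite eq_le h sq_ge0.
Qed.

(** Compactness of a self-adjoint operator, as a property of its form: up to an
    arbitrarily small multiple of the squared norm, finitely many real coordinates
    dominate it. This version is additive and is transported by unitary and
    antiunitary maps without further work. *)
Definition cptf T := forall e, 0 < e -> exists F : seq H,
  forall x, `|qf T x| <= e * sq x + \sum_(f <- F) rip x f ^+ 2.

(** A bounded real function converges along an ultrafilter, so finitely many
    coordinates oscillate little on some set of the ultrafilter. Ultrafilters thus
    play the part of weakly convergent subsequences. *)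
Lemma ultra_small (G : set_system H) (F : seq H) : UltraFilter G -> ProperFilter G ->
  G [set x | sq x <= 1] -> forall e, 0 < e ->
  exists2 A : set H, G A & forall x y, A x -> A y -> \sum_(f <- F) rip (x - y) f ^+ 2 <= e.
Proof.
move=> UG PG G1; elim: F => [|f F IH] e e0.
  exists setT; first exact: filterT.
  by move=> x y _ _; rewrite big_nil ltW.
have e2 : 0 < e / 2 by lra.
have [A GA hA] := IH _ e2.
pose C := sq f + 1.
have fb x : sq x <= 1 -> `[- C, C]%classic (rip x f).
  move=> x1; have := cauchy_schwarz x f; have := sq_ge0 f; have := sq_ge0 x => p1 p2 p3.
  have h : rip x f ^+ 2 <= C ^+ 2 by rewrite /C; nra.
  by rewrite /= in_itv /= -ler_norml -ler_sqr ?nnegrE ?real_normK ?num_real// /C; lra.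
have [p [_ cp]] : `[- C, C]%classic `&` cluster ((rip ^~ f) @ G) !=set0.
  apply: (@segment_compact R (- C) C).
  by apply: (@filterS _ G _ _ _ _ G1) => x x1; rewrite /preimage /=; move: (fb x x1).
pose d := Num.min 1 (e / 8).
have d0 : 0 < d by rewrite lt_min ltr01 /= divr_gt0.
pose D := [set x | `|p - rip x f| < d].
have GD : G D.
  have [//|nD] := in_ultra_setVsetC D UG.
  have [t [/= [x Dx <-] hx]] := cp ((rip ^~ f) @` (~` D)) (ball p d) (filterS (@preimage_image _ _ _ _) nD) (nbhsx_ballx p d d0).
  by case: Dx; rewrite /D /=.
exists (A `&` D); first exact: filterI.
move=> x y [Ax Dx] [Ay Dy]; rewrite big_cons.
have := hA _ _ Ax Ay; rewrite ripBl.
suff : (rip x f - rip y f) ^+ 2 <= e / 2 by lra.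
move: Dx Dy; rewrite /D /= !ltr_norml => /andP[a1 a2] /andP[b1 b2].
have dl : d <= 1 by rewrite /d ge_min lexx.
have de : d <= e / 8 by rewrite /d ge_min lexx orbT.
nra.
Qed.

Lemma sq_normalize x : sq x != 0 -> sq (rscale (Num.sqrt (sq x))^-1 x) = 1.
Proof.
move=> x0; rewrite sqZ exprVn sqr_sqrtr ?sq_ge0// mulVf//.
Qed.

(** Let [a] be the supremum of the form on the unit vectors of [M], and take an
    ultrafilter along which the form tends to [a]. There [a x - T x] tends to 0, by
    [psd_control]. So, for the difference [w] of two vectors far in the
    ultrafilter, the form at [w] is nearly [a * sq w]. But [cptf] bounds it by
    [a / 2 * sq w] up to finitely many coordinates, which are small by
    [ultra_small]. Hence [w] is small: the ultrafilter converges, and strongly, to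
    an eigenvector for [a]. *)
Lemma top_eigenvector T M : herm T -> cptf T -> closed_sub M ->
  (forall x, M x -> M (T x)) -> (exists2 x, M x & 0 < qf T x) ->
  exists u c, [/\ M u, sq u = 1, 0 < c, T u = rscale c u &
    forall y, M y -> qf T y <= c * sq y].
Proof.
move=> hT kT cM iM [x0 Mx0 Tx0].
have [m m0 bT] := qf_bd hT.
pose E := [set qf T x | x in [set x | M x /\ sq x = 1]].
have norE y : M y -> sq y != 0 -> E (qf T y / sq y).
  move=> My y0; exists (rscale (Num.sqrt (sq y))^-1 y).
    by split; [exact: csubZ|exact: sq_normalize].
  by rewrite qfZ// exprVn sqr_sqrtr ?sq_ge0// mulrC.
have x00 : 0 < sq x0.
  rewrite lt_neqAle sq_ge0 andbT eq_sym; apply/eqP => /sq_eq0 h.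
  by move: Tx0; rewrite h /qf rip0r ltxx.
have hE : has_sup E.
  split; first by exists (qf T x0 / sq x0); apply: norE => //; rewrite gt_eqF.
  by exists m => _ [y [My y1] <-]; have := bT y; rewrite y1 mulr1.
pose a := sup E.
have ale y : M y -> qf T y <= a * sq y.
  move=> My; have [y0|y0] := eqVneq (sq y) 0.
    by rewrite y0 (sq_eq0 y0) /qf rip0r mulr0.
  rewrite -ler_pdivrMr; last by rewrite lt_neqAle eq_sym y0 sq_ge0.
  by apply: ub_le_sup; [case: hE|exact: norE].
have a0 : 0 < a.
  have : qf T x0 / sq x0 <= a by apply: ub_le_sup; [case: hE|apply: norE => //; rewrite gt_eqF].
  by apply: lt_le_trans; rewrite divr_gt0.
pose D := fun x => rscale a x - T x.
have hD : herm D by apply: hermB => //; apply: hermZ; exact: herm_id.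
have qD x : qf D x = a * sq x - qf T x by rewrite /qf /D ripBl ripZl.
have iD x : M x -> M (D x).
  by move=> Mx; apply: csubB => //; [exact: csubZ|exact: iM].
have pD x : M x -> 0 <= qf D x by move=> Mx; rewrite qD subr_ge0 ale.
have [n n0 bD] := qf_bd hD.
have cD x : M x -> sq (D x) <= n * qf D x.
  by move=> Mx; apply: (psd_control hD cM).
pose B e := [set x | [/\ M x, sq x = 1 & a - e < qf T x]].
have FB : ProperFilter (filter_from [set e : R | 0 < e] B).
  apply: filter_from_proper; first apply: filter_from_filter.
  - by exists 1 => /=.
  - move=> i j /= i0 j0; exists (Num.min i j); first by rewrite lt_min i0.
    by move=> y [My y1 ym]; split; split=> //; apply: le_lt_trans ym; rewrite lerD2l lerN2 ge_min lexx ?orbT.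
  - by move=> e /= e0; have [_ [y [My y1] <-] yd] := sup_adherent e0 hE; exists y.
have [G [UG FG]] := ultraFilterLemma FB.
have PG : ProperFilter G by exact: ultra_proper.
have GB e : 0 < e -> G (B e) by move=> e0; apply: FG; exists e.
have BD e x : B e x -> sq (D x) <= n * e.
  move=> [Mx x1 xe]; apply: le_trans (cD _ Mx) _; rewrite ler_pM2l// qD x1; lra.
have [|l hl] := hilbert_complete PG.
  move=> e e0.
  have a2 : 0 < a / 2 by lra.
  have [F hF] := kT _ a2.
  pose d := a * e / 8.
  have d0 : 0 < d by rewrite divr_gt0// mulr_gt0.
  have [|A GA hA] := ultra_small F UG PG _ d0.
    by apply: filterS (GB 1 ltr01) => x [_ x1 _] /=; rewrite x1.
  (* e' is chosen so that a * x - T x, of squared norm at most n * e', and the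
     term d of the coordinates contribute at most a * e / 4 to a / 4 * sq w *)
  pose e' := a ^+ 2 * e / (32 * n).
  have e'0 : 0 < e' by rewrite divr_gt0// mulr_gt0// exprn_gt0.
  exists (A `&` B e'); first by apply: filterI => //; exact: GB.
  move=> x y [Ax Bx] [Ay By]; set w := x - y.
  have Mw : M w by apply: csubB => //; [case: Bx|case: By].
  have h1 : sq (D w) <= a ^+ 2 * e / 8.
    rewrite /w (linB (herm_lin hD)); apply: le_trans (sqB_le _ _) _.
    have -> : a ^+ 2 * e / 8 = 2 * (n * e') + 2 * (n * e').
      by rewrite /e'; field; rewrite gt_eqF.
    by rewrite lerD// ler_pM2l// BD.
  have h2 : qf D w <= a / 4 * sq w + a^-1 * sq (D w).
    have := sq_ge0 (rscale (a / 2) w - D w); rewrite sqB sqZ ripZl (ripC w) -/(qf D w) => h.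
    have : 0 <= a^-1 * ((a / 2) ^+ 2 * sq w - 2 * (a / 2 * qf D w) + sq (D w)).
      by apply: mulr_ge0 => //; rewrite invr_ge0 ltW.
    have -> : a^-1 * ((a / 2) ^+ 2 * sq w - 2 * (a / 2 * qf D w) + sq (D w)) =
       a / 4 * sq w - qf D w + a^-1 * sq (D w) by field; rewrite gt_eqF.
    lra.
  have h3 : a^-1 * sq (D w) <= a * e / 8.
    by rewrite ler_pdivrMl//; move: h1; rewrite expr2; lra.
  have := hF w; rewrite ler_norml => /andP[_ h4].
  have h5 := hA _ _ Ax Ay.
  rewrite qD in h2.
  have : a * sq w <= a * e by rewrite -/w /d in h5; nra.
  by rewrite ler_pM2l.
have Gl e : 0 < e -> exists2 x, B e x & sq (x - l) <= e.
  move=> e0; have [x [Bx xl]] : B e `&` [set x | sq (x - l) <= e] !=set0.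
    by apply: (@filter_ex _ G PG); apply: filterI; [exact: GB|exact: hl].
  by exists x.
have Ml : M l.
  by apply: (csub_closed cM) => e /Gl [x [Mx _ _] h]; exists x => //; rewrite sqBC.
have Dl : D l = 0.
  have [k k0 kD] := herm_bd hD.
  apply: (@sq_eq0_eps _ (2 * n + 2 * k)); first lra.
  move=> e /Gl [x Bx xl].
  have -> : D l = D x - D (x - l) by rewrite (linB (herm_lin hD)) opprB addrC subrK.
  apply: le_trans (sqB_le _ _) _.
  have := BD _ _ Bx; have := kD (x - l); nra.
(* only l <> 0 is established; the eigenvector is normalized afterwards *)
have l0 : sq l != 0.
  apply/eqP => /sq_eq0 l0; have /Gl [x [_ x1 _]] : 0 < 2^-1 :> R by lra.
  by rewrite l0 subr0 x1; lra.
exists (rscale (Num.sqrt (sq l))^-1 l), a; split=> //.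
- exact: csubZ.
- exact: sq_normalize.
- rewrite (linR (herm_lin hT)) rscaleA mulrC -rscaleA; congr rscale.
  by move/eqP: Dl; rewrite subr_eq0 => /eqP.
Qed.
End Operators.

(** * Compact self-adjoint operators and the trace distance *)
Section Spectral.
Context {R : realType} {H : hilbertType R}.
Implicit Types (x y z u v w : H) (T A B S P : H -> H) (M V E : set H) (a b c e : R).

Definition orth V : set H := [set x | forall v, V v -> inner x v = 0].

Lemma closed_sub_orth V : closed_sub (orth V).
Proof.
split.
- by move=> v Vv; rewrite linear0l.
- by move=> x y ox oy v Vv; rewrite linearDl /= ox// oy// addr0.
- by move=> k x ox v Vv; rewrite linearZl_LR /= ox// mulr0.
- move=> x hx v Vv; apply/inner0.
  suff h w : (forall y, orth V y -> rip y w = 0) -> rip x w = 0.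
    by split; apply: h => y /(_ _ Vv) /inner0[].
  move=> hw; apply/eqP; rewrite -sqrf_eq0 eq_le sqr_ge0 andbT.
  apply: (le0_eps (sq_ge0 w)) => e /hx [y /hw y0 hy].
  have -> : rip x w = rip (x - y) w by rewrite ripBl y0 subr0.
  by apply: le_trans (cauchy_schwarz _ _) _; rewrite ler_wpM2r// sq_ge0.
Qed.

Lemma closed_sub_setT : closed_sub (@setT H).
Proof. by []. Qed.

Lemma orthP V x v : orth V x -> V v -> rip x v = 0.
Proof. by move=> ox /ox /inner0[]. Qed.

Lemma orth_invariant T V : herm T -> (forall v, V v -> V (T v)) ->
  forall x, orth V x -> orth V (T x).
Proof. by move=> hT iV x ox v /iV Vv; rewrite herm_inner//; exact: ox. Qed.

Definition eigen T : set H := [set v | exists c, T v = rscale c v].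
Lemma orth_eigen_invariant T V : herm T -> V `<=` eigen T ->
  forall x, orth V x -> orth V (T x).
Proof.
move=> hT sV x ox v Vv; have [c Tv] := sV _ Vv.
by rewrite herm_inner// Tv /rscale linearZr_LR /= (ox _ Vv) mulr0.
Qed.

Lemma cptfD A B : herm A -> herm B -> cptf A -> cptf B -> cptf (fun x => A x + B x).
Proof.
move=> hA hB kA kB e e0; have e2 : 0 < e / 2 by lra.
have [F hF] := kA _ e2; have [G hG] := kB _ e2.
exists (F ++ G) => x; rewrite big_cat /= /qf ripDl.
apply: le_trans (ler_normD _ _) _; have := hF x; have := hG x; rewrite /qf; lra.
Qed.
Lemma cptfN A : cptf A -> cptf (fun x => - A x).
Proof. by move=> kA e /kA[F hF]; exists F => x; rewrite /qf ripNl normrN; exact: hF. Qed.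
Lemma cptfB A B : herm A -> herm B -> cptf A -> cptf B -> cptf (fun x => A x - B x).
Proof. by move=> hA hB kA kB; apply: cptfD => //; [exact: hermN|exact: cptfN]. Qed.

(** Apply [top_eigenvector] to [T] or to [- T]. If neither form takes a positive
    value on [M], then [T] vanishes on [M], and every vector of [M] is an
    eigenvector. *)
Lemma spectral_total T M x : herm T -> cptf T -> closed_sub M ->
  (forall x, M x -> M (T x)) -> M x -> x <> 0 ->
  exists2 u, M u & sq u = 1 /\ eigen T u.
Proof.
move=> hT kT cM iM Mx x0.
have [/(top_eigenvector hT kT cM iM) [u [c [Mu u1 _ Tu _]]]|npos] :=
  pselect (exists2 y, M y & 0 < qf T y).
  by exists u => //; split => //; exists c.
have iMN y : M y -> M (- T y) by move=> My; apply: csubN => //; exact: iM.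
have [/(top_eigenvector (hermN hT) (cptfN kT) cM iMN) [u [c [Mu u1 _ Tu _]]]|nneg] :=
  pselect (exists2 y, M y & 0 < qf (fun x => - T x) y).
  by exists u => //; split => //; exists (- c); rewrite rscaleN -Tu opprK.
have z y : M y -> qf T y = 0.
  move=> My; apply/eqP; rewrite eq_le; apply/andP; split; rewrite leNgt; apply/negP => h.
    by apply: npos; exists y.
  by apply: nneg; exists y => //; rewrite /qf ripNl oppr_gt0.
have Tx : T x = 0.
  by apply: (psd_eq0 hT cM iM _ Mx (z _ Mx)) => y /z ->.
have sx : sq x != 0 by apply/eqP => /sq_eq0.
exists (rscale (Num.sqrt (sq x))^-1 x); first exact: csubZ.
split; first exact: sq_normalize.
by exists 0; rewrite (linR (herm_lin hT)) Tx rscale0 rscale0l.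
Qed.

Lemma orth_eigen_eq0 T x : herm T -> cptf T -> orth (eigen T) x -> x = 0.
Proof.
move=> hT kT ox; apply: contrapT => x0.
have [u ou [u1 Tu]] := spectral_total hT kT (closed_sub_orth _)
  (orth_eigen_invariant hT (@subset_refl _ _)) ox x0.
by have := orthP ou Tu; rewrite -/(sq u) u1; lra.
Qed.

Definition orthoset E : Prop :=
  (forall v, E v -> sq v = 1) /\ (forall v w, E v -> E w -> v <> w -> inner v w = 0).

(** Zorn's lemma. With all the vectors for [V] this yields orthonormal bases,
    with the eigenvectors of an operator it yields bases that diagonalize it. *)
Lemma max_orthonormal V : exists E, [/\ E `<=` V, orthoset E &
  forall v, V v -> sq v = 1 -> ~ (forall w, E w -> inner v w = 0)].
Proof.
have [|E [[sE oE] mE]] := @Zorn_bigcup H (fun E => E `<=` V /\ orthoset E).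
  move=> F FP tF; split; first by move=> x [X /FP[+ _]]; exact.
  split; first by move=> x [X /FP[_ [+ _]]]; exact.
  move=> x y [X FX Xx] [Y FY Yy].
  have [XY|YX] := tF _ _ FX FY.
    by have [_ [_ h]] := FP _ FY; apply: h => //; exact: XY.
  by have [_ [_ h]] := FP _ FX; apply: h => //; exact: YX.
exists E; split=> // v Vv v1 ov.
apply: (mE (E `|` [set v])); last first.
  split; first by move=> x [/sE//|->].
  split; first by move=> x [/(proj1 oE)//|->].
  move=> x y [Ex|->] [Ey|->] xy; rewrite ?ov//; first exact: (proj2 oE).
  by rewrite innerC ov// conjc0.
rewrite properEneq; split; last by left.
apply/eqP => h; have Ev : E v by rewrite h; right.
by have := ov _ Ev; rewrite inner_sq v1 => -[]; lra.
Qed.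

Lemma orthonormal_basisP E : orthonormal_basis E <->
  orthoset E /\ forall x, orth E x -> x = 0.
Proof.
split.
  move=> [e1 ef ex]; split=> //; split=> // e /e1; rewrite inner_sq; by case.
by move=> [[e1 ef] ex]; split=> // e /e1; rewrite inner_sq => ->.
Qed.

Lemma eigenbasis T : herm T -> cptf T -> exists2 E, orthonormal_basis E & E `<=` eigen T.
Proof.
move=> hT kT; have [E [sE oE mE]] := max_orthonormal (eigen T).
exists E => //; apply/orthonormal_basisP; split=> // x ox; apply: contrapT => x0.
have [u ou [u1 Tu]] := spectral_total hT kT (closed_sub_orth _)
  (orth_eigen_invariant hT sE) ox x0.
exact: (mE u Tu u1 ou).
Qed.

Lemma onb_basis : orthonormal_basis (@onb R H).
Proof.
rewrite /onb; apply: xgetPex; have [E [_ oE mE]] := max_orthonormal setT.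
exists E; apply/orthonormal_basisP; split=> // x ox; apply: contrapT => x0.
have sx : sq x != 0 by apply/eqP => /sq_eq0.
apply: (mE (rscale (Num.sqrt (sq x))^-1 x)) => //; first exact: sq_normalize.
by have := csubZ (closed_sub_orth E) (Num.sqrt (sq x))^-1%:C%C ox.
Qed.

Definition pos T : Prop := herm T /\ forall x, 0 <= qf T x.

(** A form with real values comes from a symmetric operator: polarize at
    [x + J y]. *)
Lemma positive_opP T : positive_op T <-> pos T.
Proof.
split.
  move=> [[lT [m hm]] pT].
  have im x : rip (T x) (J x) = 0.
    by have := pT x; rewrite innerE lecE /= => /andP[/eqP].
  have qT x : 0 <= qf T x.
    by have := pT x; rewrite innerE lecE /= => /andP[].
  split=> //; split=> //.
    exists (complex.Re m ^+ 2 + 1); first by have := sqr_ge0 (complex.Re m); lra.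
    move=> x; have [s0|s0] := eqVneq (sq x) 0.
      by rewrite (sq_eq0 s0) (lin0 lT) sq0 mulr0.
    have := hm x; rewrite !norm_sq; case: m {hm} => p q.
    rewrite lecE /= => /andP[_]; rewrite mulr0 subr0 => h.
    have := sqrtr_ge0 (sq (T x)) => t0.
    have := sqr_sqrtr (sq_ge0 x); have := sqr_sqrtr (sq_ge0 (T x)).
    move: h t0; set t := Num.sqrt (sq (T x)); set s := Num.sqrt _ => h t0 <- <-.
    have : t ^+ 2 <= (p * s) ^+ 2 by rewrite ler_sqr ?nnegrE//; lra.
    rewrite exprMn; have := sqr_ge0 s; lra.
  move=> x y.
  have := im (x + J y); rewrite (linD lT) JD JJ (linJ lT) !(ripDl, ripDr) !ripNr im ripJJ ripJl im.
  rewrite (ripC (T y)); lra.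
move=> [hT pT]; split.
  split; first exact: (herm_lin hT).
  have [m m0 bT] := herm_bd hT; exists (Num.sqrt m)%:C%C => x.
  rewrite !norm_sq -rmorphM /= lecR -sqrtrM ?(ltW m0)// ler_sqrt//.
  by rewrite mulr_ge0 ?sq_ge0 ?ltW.
move=> x; rewrite innerE.
have -> : rip (T x) (J x) = 0.
  have := herm_sa hT x (J x); rewrite (linJ (herm_lin hT)) (ripC x) ripJl; lra.
by rewrite complexr0 ler0c; exact: pT.
Qed.

Lemma adjoint_herm T : herm T -> adjoint T = T.
Proof.
move=> hT; apply: xget_unique; first by move=> x y; exact: herm_inner.
move=> B hB; apply/funext => y; apply: eq_rip => z.
by rewrite ripC (ripC _ z) /rip -hB herm_inner.
Qed.

(** The vector [f := B v - `|c| v] satisfies [B f = - `|c| f], which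
    contradicts the positivity of [B] unless [f = 0]. *)
Lemma sqrt_eigen S B v c : pos B -> (forall x, B (B x) = S (S x)) -> herm S ->
  S v = rscale c v -> B v = rscale `|c| v.
Proof.
move=> [hB pB] hBB hS Sv.
have BBv : B (B v) = rscale (c ^+ 2) v.
  by rewrite hBB Sv (linR (herm_lin hS)) Sv rscaleA -expr2.
have [c0|c0] := eqVneq c 0.
  rewrite c0 normr0 rscale0l; apply: sq_eq0.
  by rewrite /sq -(herm_sa hB) BBv c0 expr0n /= rscale0l rip0l.
pose f := B v - rscale `|c| v.
have Bf : B f = - rscale `|c| f.
  rewrite /f (linB (herm_lin hB)) (linR (herm_lin hB)) BBv.
  rewrite [rscale _ (_ - _)]scalerBr -!/(rscale _ _) rscaleA -expr2 real_normK ?num_real//.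
  by rewrite opprB.
have := pB f; rewrite /qf Bf ripNl ripZl => h.
have c1 : 0 < `|c| by rewrite normr_gt0.
have : sq f = 0 by apply/eqP; rewrite eq_le sq_ge0 andbT; move: h; rewrite -/(sq f); nra.
by move/sq_eq0/eqP; rewrite subr_eq0 => /eqP.
Qed.

(** Positive square roots of [S \o S] agree on the eigenvectors of [S], by
    [sqrt_eigen], and no nonzero vector is orthogonal to all of these. *)
Lemma sqrt_unique S B C : herm S -> cptf S -> pos B -> pos C ->
  (forall x, B (B x) = S (S x)) -> (forall x, C (C x) = S (S x)) -> B = C.
Proof.
move=> hS kS pB pC hB hC; apply/funext => x; apply/eqP; rewrite -subr_eq0; apply/eqP.
apply: (orth_eigen_eq0 hS kS) => v [c Sv].
rewrite linearBl /= (herm_inner _ _ (proj1 pB)) (herm_inner _ _ (proj1 pC)).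
by rewrite (sqrt_eigen pB hB hS Sv) (sqrt_eigen pC hC hS Sv) subrr.
Qed.

Lemma absop_eq S C : herm S -> cptf S -> pos C -> (forall x, C (C x) = S (S x)) ->
  absop S = C.
Proof.
move=> hS kS pC hC; apply: xget_unique.
  split; first exact/positive_opP.
  by rewrite adjoint_herm//; apply/funext.
move=> B [/positive_opP pB]; rewrite adjoint_herm// => hB.
apply: (sqrt_unique hS kS pB pC _ hC) => x.
by have := congr1 (@^~ x) hB.
Qed.

(** Linearity follows from the uniqueness of the orthogonal decomposition. *)
Lemma projection_op M : closed_sub M -> exists P, [/\ herm P,
  forall x, M (P x), forall x m, M m -> rip (x - P x) m = 0 &
  forall x, sq (P x) <= sq x].
Proof.
move=> cM.
have /choice[P hP] : forall x, exists p, M p /\ forall m, M m -> rip (x - p) m = 0.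
  by move=> x; have [p Mp hp] := projection_theorem x cM; exists p.
have MP x : M (P x) by case: (hP x).
have oP x m : M m -> rip (x - P x) m = 0 by move=> Mm; case: (hP x) => _; exact.
have uP x p : M p -> (forall m, M m -> rip (x - p) m = 0) -> p = P x.
  move=> Mp op; apply/eqP; rewrite -subr_eq0; apply/eqP/sq_eq0.
  have Md : M (p - P x) by exact: csubB.
  have := op _ Md; have := oP x _ Md; rewrite /sq; rewrite !(ripBl, ripBr); lra.
have cP x : sq (P x) <= sq x.
  have := oP x _ (MP x); have := sq_ge0 (x - P x); rewrite sqB ripBl -/(sq (P x)); lra.
exists P; split=> //; split.
- move=> k x y; apply/esym/uP; first by apply: csubD => //; exact: csubZ.
  move=> m Mm.
  have -> : k *: x + y - (k *: P x + P y) = k *: (x - P x) + (y - P y).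
    by rewrite scalerBr opprD addrACA.
  have Jm : M (J m) by exact: csubZ.
  by rewrite scaleE [LHS]ripDl [X in X + _]ripDl 2!ripZl ripJl !oP// oppr0 !mulr0 !addr0.
- by exists 1 => // x; rewrite mul1r.
- move=> x y; have := oP x _ (MP y); have := oP y _ (MP x).
  rewrite !ripBl (ripC y) (ripC (P y)); lra.
Qed.

(** [P] is the projection onto the first term of an [S]-invariant decomposition
    of [H] into a part where [S] is nonnegative and one where it is nonpositive:
    a Jordan decomposition of [S]. *)
Definition splits S P : Prop := herm P /\ [/\
  forall x, P (P x) = P x, forall x, P (S x) = S (P x),
  forall x, 0 <= qf S (P x) & forall x, qf S (x - P x) <= 0].

(** The absolute value of [S] is [S P - S (1 - P) = 2 S P - S]: this operator is
    positive, and its square is the one of [S] since [P] and [S] commute. *)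
Lemma absop_split S P : herm S -> cptf S -> splits S P ->
  pos (absop S) /\ forall x, qf (absop S) x = 2 * qf S (P x) - qf S x.
Proof.
move=> hS kS [hP [PP PS pP nP]].
have rSP x y : rip (S (P x)) y = rip (S (P x)) (P y).
  by rewrite -{1}(PP x) -PS (herm_sa hP).
have eSP x : rip (S x) (P x) = qf S (P x) by rewrite (herm_sa hS) ripC rSP.
pose C := fun x => rscale 2 (S (P x)) - S x.
have hSP : herm (fun x => S (P x)).
  have [n n0 bS] := herm_bd hS; have [m m0 bP] := herm_bd hP; split.
  - by move=> k x y; rewrite (herm_lin hP) (herm_lin hS).
  - exists (n * m); first exact: mulr_gt0.
    by move=> x; apply: le_trans (bS _) _; rewrite -mulrA ler_pM2l.
  - by move=> x y; rewrite (herm_sa hS) (herm_sa hP) PS.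
have hC : herm C by apply: hermB => //; exact: hermZ.
have qC x : qf C x = 2 * qf S (P x) - qf S x.
  by rewrite /qf /C ripBl ripZl rSP.
suff -> : absop S = C.
  split=> //; split=> // x; rewrite qC.
  have := pP x; have := nP x; rewrite qfB// eSP; lra.
apply: absop_eq => //.
  split=> // x; rewrite qC.
  have := pP x; have := nP x; rewrite qfB// eSP; lra.
move=> x; have lS := herm_lin hS; have lP := herm_lin hP.
have r2 z : rscale 2 z - z = z.
  by rewrite -[X in _ - X]rscale1 -rscaleN -rscaleDl -[RHS]rscale1; congr rscale; ring.
have PC : P (C x) = S (P x) by rewrite /C (linB lP) (linR lP) !PS PP r2.
rewrite {1}/C PC /C (linB lS) (linR lS) opprB addrC subrK//.
Qed.

(** Let [M] be the orthogonal complement of the eigenvectors of [S] with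
    nonpositive eigenvalues. A negative value of the form on [M] would give such an
    eigenvector inside [M]. A positive value on the complement of [M] would give
    an eigenvector with positive eigenvalue in there; being orthogonal to the
    eigenvectors with nonpositive eigenvalues, it would also lie in [M]. *)
Lemma jordan S : herm S -> cptf S ->
  exists2 P, splits S P & forall x, sq (P x) <= sq x.
Proof.
move=> hS kS.
pose N := [set v | exists2 c, c <= 0 & S v = rscale c v].
have cM := closed_sub_orth N; set M := orth N in cM.
have iM x : M x -> M (S x).
  by apply: orth_eigen_invariant => // v [c _ Sv]; exists c.
have [P [hP MP oP cP]] := projection_op cM.
exists P; last exact: cP.
have Pid x : M x -> P x = x.
  move=> Mx; apply/eqP; rewrite -subr_eq0; apply/eqP/sq_eq0; rewrite sqBC.
  by rewrite /sq oP//; exact: (csubB cM Mx (MP x)).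
have P0 x : (forall m, M m -> rip x m = 0) -> P x = 0.
  by move=> ox; apply: sq_eq0; rewrite /sq (herm_sa hP) Pid// ox.
have PS x : P (S x) = S (P x).
  rewrite -{1}(subrK (P x) x) (linD (herm_lin hS)) (linD (herm_lin hP)).
  rewrite (Pid (S (P x))); last exact: iM.
  rewrite P0 ?add0r// => m Mm; rewrite (herm_sa hS) oP//; exact: iM.
have o2 x : orth M (x - P x).
  by move=> m Mm; apply/inner0; rewrite !oP//; exact: (csubZ cM _ Mm).
split=> //; split=> // x.
- exact: Pid.
- rewrite leNgt; apply/negP => h.
  have [||u [c [Mu u1 c0 Su _]]] := top_eigenvector (hermN hS) (cptfN kS) cM.
  + by move=> y My; exact: (csubN cM (iM _ My)).
  + by exists (P x) => //; rewrite /qf ripNl oppr_gt0.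
  have Nu : N u by exists (- c); [lra|rewrite rscaleN -Su opprK].
  by have := orthP Mu Nu; rewrite -/(sq u) u1; lra.
- rewrite leNgt; apply/negP => h.
  have [||u [c [Mu u1 c0 Su _]]] := top_eigenvector hS kS (closed_sub_orth M).
  + exact: orth_invariant.
  + by exists (x - P x).
  suff Nu : M u by have := orthP Mu Nu; rewrite -/(sq u) u1; lra.
  move=> v [d d0 Sv].
  have g w : S w = rscale d w -> rip u w = 0.
    move=> Sw; have := herm_sa hS u w; rewrite Su Sw ripZl ripZr => cd.
    have /eqP : (c - d) * rip u w = 0 by lra.
    by rewrite mulf_eq0 => /orP[/eqP|/eqP//]; lra.
  by apply/inner0; split; apply: g => //; rewrite (linJ (herm_lin hS)) Sv JZ.
Qed.

(** The states, with the compactness that results from a finite trace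
    ([statesP]). *)
Definition state_op A := [/\ pos A, cptf A & tr A = 1%E].

(** As [A - B] has trace 0, its positive and negative parts have the same trace.
    The computation compares the traces of [absop S + A] and [2 S P + B], which are
    equal operators, so that all the sums have nonnegative terms. *)
Lemma d1E A B P : state_op A -> state_op B -> splits (fun x => A x - B x) P ->
  d1 A B = (\esum_(e in @onb R H) (qf (fun x => A x - B x) (P e))%:E +
            \esum_(e in @onb R H) (qf (fun x => A x - B x) (P e))%:E)%E.
Proof.
move=> [[hA pA] kA tA] [[hB pB] kB tB].
set S := fun x => A x - B x => sp; have [_ [_ _ pP _]] := sp.
have hS : herm S by exact: hermB.
have kS : cptf S by exact: cptfB.
have [[_ pC] qC] := absop_split hS kS sp.
have -> : d1 A B = tr (absop S) by [].
have : (tr (absop S) + tr A = (\esum_(e in @onb R H) (qf S (P e))%:E +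
            \esum_(e in @onb R H) (qf S (P e))%:E) + tr B)%E.
  rewrite /tr -!esumD; try by move=> i _; rewrite -?EFinD lee_fin;
    first [exact: pP|exact: pA|exact: pB|exact: pC|exact: (addr_ge0 (pP _) (pP _))].
  apply: eq_esum => e _; rewrite -!EFinD; congr EFin.
  have := qC e; rewrite -/(qf (absop S) e) -/(qf A e) -/(qf B e) => h.
  rewrite -![complex.Re _]/(rip _ _) -/(qf _ _) h {2}/qf /S ripBl -/(qf A e) -/(qf B e).
  rewrite /qf; lra.
by rewrite tA tB => /(congr1 (fun r : \bar R => (r - 1)%E)); rewrite !addeK.
Qed.

End Spectral.

(** * Orthonormal bases and traces *)
Section Bases.
Context {R : realType} {H : hilbertType R}.
Implicit Types (x y z u v w : H) (T A B S P : H -> H) (M V E : set H) (a b c : R) (s g : seq H).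

Lemma mod2Dl0 x y e : inner y e = 0 -> mod2 (x + y) e = mod2 x e.
Proof. by move=> /inner0[h1 h2]; rewrite /mod2 !ripDl h1 h2 !addr0. Qed.

Lemma qfJ A x : herm A -> qf A (J x) = qf A x.
Proof. by move=> hA; rewrite /qf (linJ (herm_lin hA)) ripJJ. Qed.
Lemma ripAJ A x : herm A -> rip (A x) (J x) = 0.
Proof.
move=> hA; have := herm_sa hA x (J x); rewrite (linJ (herm_lin hA)) (ripC x) ripJl; lra.
Qed.
Lemma qfZc A (k : R[i]) x : herm A ->
  qf A (k *: x) = (complex.Re k ^+ 2 + complex.Im k ^+ 2) * qf A x.
Proof.
move=> hA; rewrite scaleE qfD// !qfZ// qfJ// (linR (herm_lin hA)) ripZl ripZr ripAJ//; ring.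
Qed.
Lemma qf_inner A x y e : herm A -> qf A (inner x y *: e) = mod2 x y * qf A e.
Proof. by move=> hA; rewrite qfZc// innerE. Qed.
Lemma sqZc (k : R[i]) x : sq (k *: x) = (complex.Re k ^+ 2 + complex.Im k ^+ 2) * sq x.
Proof. exact: (qfZc k x herm_id). Qed.
Lemma rip_inner x e : rip x (inner x e *: e) = mod2 x e.
Proof. by rewrite innerE scaleE /= ripDr !ripZr /mod2 !expr2. Qed.

Lemma qf_cauchy_schwarz A x y : pos A -> rip (A x) y ^+ 2 <= qf A x * qf A y.
Proof.
move=> [hA pA]; set b := rip (A x) y.
have key t : 0 <= qf A x * t ^+ 2 + 2 * t * b + qf A y.
  have := pA (rscale t x + y); rewrite qfD// qfZ// (linR (herm_lin hA)) ripZl -/b; lra.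
have := pA x; have := pA y; move: key; set p := qf A x; set q := qf A y => key q0 p0.
have [p00|p00] := eqVneq p 0.
  suff -> : b = 0 by rewrite p00 expr0n mul0r.
  apply: contrapT => /eqP b0.
  have := key (- (q + 1) / (2 * b)).
  have -> : 2 * (- (q + 1) / (2 * b)) * b = - (q + 1) by field.
  by rewrite p00; lra.
have p1 : 0 < p by rewrite lt_neqAle eq_sym p00.
have := key (- b / p).
have -> : p * (- b / p) ^+ 2 + 2 * (- b / p) * b + q = p^-1 * (p * q - b ^+ 2) by field.
by rewrite pmulr_rge0 ?invr_gt0// subr_ge0.
Qed.

Lemma qfD_le A x y : pos A -> qf A (x + y) <= 2 * qf A x + 2 * qf A y.
Proof. by move=> [hA pA]; have := pA (x - y); rewrite qfB// qfD//; lra. Qed.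

(** The triangle inequality for the seminorm of a positive form, followed by the
    Cauchy-Schwarz inequality for the sum. *)
Lemma qf_sum_le A s x : pos A ->
  qf A (\sum_(e <- s) inner x e *: e) <= (\sum_(e <- s) qf A e) * \sum_(e <- s) mod2 x e.
Proof.
move=> pA; have hA := proj1 pA; elim: s => [|e s IH].
  by rewrite !big_nil /qf rip0r mul0r.
rewrite !big_cons; set u := \sum_(i <- s) _; set v := inner x e *: e.
have qv : qf A v = mod2 x e * qf A e by rewrite qf_inner.
rewrite qfD// qv.
have cs : rip (A v) u ^+ 2 <= (mod2 x e * qf A e) * qf A u.
  by rewrite -qv; exact: qf_cauchy_schwarz.
have q0 := proj2 pA e; have m0 := mod2_ge0 x e; have u0 := proj2 pA u.
have : 0 <= \sum_(i <- s) qf A i by apply: sumr_ge0 => i _; exact: (proj2 pA).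
have : 0 <= \sum_(i <- s) mod2 x i by apply: sumr_ge0 => i _; exact: mod2_ge0.
move: cs q0 m0 u0 IH; rewrite -/u; set r := rip _ _; set q := qf A e; set m := mod2 x e; set t := qf A u.
set b := \sum_(i <- s) mod2 x i; set a := \sum_(i <- s) qf A i => cs q0 m0 u0 IH b0 a0.
have : 2 * r <= m * a + q * b.
  have [r0|r0] := lerP r 0.
    by apply: (@le_trans _ _ 0); [lra|rewrite addr_ge0// mulr_ge0].
  have n0 : 0 <= m * a + q * b by rewrite addr_ge0// mulr_ge0.
  (* r ^+ 2 <= (m * a) * (q * b), and the geometric mean is at most the
     arithmetic one *)
  rewrite -ler_sqr ?nnegrE//; last lra.
  have : m * q * t <= m * q * (a * b) by rewrite ler_wpM2l// mulr_ge0.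
  have := sqr_ge0 (m * a - q * b); nra.
lra.
Qed.

Definition proj s x : H := \sum_(e <- s) inner x e *: e.

Lemma proj_cons e s x : proj (e :: s) x = inner x e *: e + proj s x.
Proof. by rewrite /proj big_cons. Qed.
Lemma projD s x y : proj s (x + y) = proj s x + proj s y.
Proof. by rewrite /proj -big_split; apply: eq_bigr => e _; rewrite linearDl scalerDl. Qed.
Lemma projN s x : proj s (- x) = - proj s x.
Proof. by rewrite /proj -sumrN; apply: eq_bigr => e _; rewrite linearNl scaleNr. Qed.
Lemma projB s x y : proj s (x - y) = proj s x - proj s y.
Proof. by rewrite projD projN. Qed.
Lemma projZ s (k : R[i]) x : proj s (k *: x) = k *: proj s x.
Proof. by rewrite /proj scaler_sumr; apply: eq_bigr => e _; rewrite linearZl_LR scalerA. Qed.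

Section Fam.
Variable E : set H.
Hypothesis oE : orthoset E.

Lemma inner_proj_out s x f : {subset s <= E} -> E f -> f \notin s -> inner (proj s x) f = 0.
Proof.
move=> sE Ef; rewrite /proj; elim: s sE => [|e s IH] sE.
  by rewrite big_nil linear0l.
rewrite inE negb_or => /andP[fe fs]; rewrite big_cons linearDl /= linearZl_LR /=.
rewrite IH//; last by move=> y ys; apply: sE; rewrite inE ys orbT.
have Ee : E e by apply/set_mem/sE; rewrite inE eqxx.
rewrite (proj2 oE _ _ Ee Ef) ?mulr0 ?addr0// => ef.
by rewrite ef eqxx in fe.
Qed.

Lemma inner_proj_in s x f : {subset s <= E} -> uniq s -> f \in s ->
  inner (proj s x) f = inner x f.
Proof.
move=> sE; rewrite /proj; elim: s sE => [//|e s IH] sE /= /andP[es us].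
have sE' : {subset s <= E} by move=> y ys; apply: sE; rewrite inE ys orbT.
have Ee : E e by apply/set_mem/sE; rewrite inE eqxx.
rewrite big_cons linearDl /= linearZl_LR /= inE => /orP[/eqP->|fs].
  rewrite (inner_proj_out x sE' Ee es) addr0 inner_sq (proj1 oE)// mulr1//.
rewrite IH// (proj2 oE _ _ Ee) ?mulr0 ?add0r//.
  by apply/set_mem/sE'.
by move=> ef; rewrite ef fs in es.
Qed.

(** Removing the components along eigenvectors removes their contributions to the
    form. The case of the identity is Pythagoras' theorem ([sq_sub_proj]). *)
Lemma qf_sub_proj A s x : herm A -> E `<=` eigen A -> {subset s <= E} -> uniq s ->
  qf A (x - proj s x) = qf A x - \sum_(e <- s) qf A e * mod2 x e.
Proof.
move=> hA eA; elim: s => [|e s IH] sE.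
  by rewrite /proj !big_nil !subr0.
have sE' : {subset s <= E} by move=> y ys; apply: sE; rewrite inE ys orbT.
have Ee : E e by apply/set_mem/sE; rewrite inE eqxx.
move=> /= /andP[es us]; rewrite big_cons proj_cons.
pose r := x - proj s x.
have ir : inner r e = inner x e.
  by rewrite /r linearBl /= (inner_proj_out x sE' Ee es) subr0.
have -> : x - (inner x e *: e + proj s x) = r - inner r e *: e.
  by rewrite ir /r opprD addrA addrAC.
have mr : mod2 r e = mod2 x e by apply: complexI; rewrite !mod2E ir.
have [c Ae] := eA _ Ee; have e1 := proj1 oE _ Ee.
have qe : qf A e = c by rewrite /qf Ae ripZl -/(sq e) e1 mulr1.
rewrite qfB// IH// qf_inner// (herm_sa hA) (linZ (herm_lin hA)) Ae.
have -> : inner r e *: rscale c e = rscale c (inner r e *: e) by rewrite /rscale !scalerA mulrC.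
rewrite ripZr rip_inner qe mr; ring.
Qed.

Lemma sq_sub_proj s x : {subset s <= E} -> uniq s ->
  sq (x - proj s x) = sq x - \sum_(e <- s) mod2 x e.
Proof.
move=> sE us; have := @qf_sub_proj id s x (herm_id) _ sE us.
rewrite /qf /= -!/(sq _) => ->; last by move=> v _; exists 1; rewrite rscale1.
congr (_ - _); rewrite big_seq [RHS]big_seq; apply: eq_bigr => e es.
by rewrite -/(sq e) (proj1 oE) ?mul1r//; apply/set_mem/sE.
Qed.

Lemma sq_sub_proj_le s x : {subset s <= E} -> uniq s -> sq (x - proj s x) <= sq x.
Proof.
by move=> sE us; rewrite sq_sub_proj// gerBl sumr_ge0// => e _; exact: mod2_ge0.
Qed.
Inductive span : set H :=
| span0 : span 0
| spanS (k : R[i]) e y : E e -> span y -> span (k *: e + y).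

Lemma spanD x y : span x -> span y -> span (x + y).
Proof. by elim=> [|k e z Ee _ IH] sy; rewrite ?add0r// -addrA; apply: spanS => //; exact: IH. Qed.
Lemma spanZ (k : R[i]) x : span x -> span (k *: x).
Proof.
elim=> [|l e z Ee _ IH]; first by rewrite scaler0; exact: span0.
by rewrite scalerDr scalerA; apply: spanS.
Qed.
Lemma span_proj y : span y -> exists s, [/\ {subset s <= E}, uniq s & proj s y = y].
Proof.
elim=> [|k e z Ee _ [s [sE us pz]]].
  by exists [::]; split=> //; rewrite /proj big_nil.
have pe g : {subset g <= E} -> uniq g -> e \in g -> proj g e = e.
  move=> gE ug eg; rewrite /proj (bigD1_seq e)//= inner_sq (proj1 oE)// scale1r.
  rewrite big_seq_cond big1 ?addr0// => f /andP[fg fe].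
  rewrite (proj2 oE) ?scale0r//; first by apply/set_mem/gE.
  by move=> ef; rewrite ef eqxx in fe.
have [es|es] := boolP (e \in s).
  by exists s; split=> //; rewrite projD projZ pe// pz.
have gE : {subset e :: s <= E}.
  by move=> w; rewrite inE => /orP[/eqP->|/sE//]; exact: mem_set.
have ug : uniq (e :: s) by rewrite /= es.
exists (e :: s); split=> //.
rewrite projD projZ pe ?inE ?eqxx// proj_cons -{1}pz.
by rewrite (inner_proj_out z sE Ee es) scale0r add0r pz.
Qed.
End Fam.

(** The closure of the span of a basis is a closed subspace with trivial
    complement, so the projection theorem makes it everything; and among the linear
    combinations of the entries of [s], the closest to [x] is [proj s x]. *)
Lemma dense E x a : orthonormal_basis E -> 0 < a ->
  exists s, [/\ {subset s <= E}, uniq s & sq (x - proj s x) <= a].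
Proof.
move=> /orthonormal_basisP[oE bE].
pose V := [set x | forall a, 0 < a -> exists2 y, span E y & sq (x - y) <= a].
have cV : closed_sub V.
  split.
  - by move=> b b0; exists 0; [exact: span0|rewrite subr0 sq0 ltW].
  - move=> y z Vy Vz b b0; have b4 : 0 < b / 4 by lra.
    have [y' sy hy] := Vy _ b4; have [z' sz hz] := Vz _ b4.
    exists (y' + z'); first exact: spanD.
    by rewrite opprD addrACA; apply: le_trans (sqD_le _ _) _; lra.
  - move=> k y Vy b b0; pose n := complex.Re k ^+ 2 + complex.Im k ^+ 2.
    have n0 : 0 <= n by rewrite addr_ge0 ?sqr_ge0.
    have bn : 0 < b / (n + 1) by rewrite divr_gt0//; lra.
    have [y' sy hy] := Vy _ bn; exists (k *: y'); first exact: spanZ.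
    rewrite -scalerBr sqZc -/n.
    apply: (@le_trans _ _ ((n + 1) * (b / (n + 1)))).
      by apply: ler_pM => //; [exact: sq_ge0|lra].
    by rewrite mulrC divfK// gt_eqF//; lra.
  - move=> y hy b b0; have b4 : 0 < b / 4 by lra.
    have [y' Vy' hy'] := hy _ b4; have [z sz hz] := Vy' _ b4.
    exists z => //; rewrite -(subrK y' y) -addrA.
    by apply: le_trans (sqD_le _ _) _; lra.
have Vx : V x.
  have [p Vp op] := projection_theorem x cV.
  suff : x - p = 0 by move/eqP; rewrite subr_eq0 => /eqP->.
  apply: bE => e Ee.
  have Ve : V e.
    move=> b b0; exists e; last by rewrite subrr sq0 ltW.
    by rewrite -[e]addr0 -[e]scale1r; apply: spanS => //; exact: span0.
  by apply/inner0; rewrite !op//; exact: (csubZ cV _ Ve).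
move=> a0; have [y sy hy] := Vx _ a0.
have [s [sE us py]] := span_proj oE sy.
exists s; split=> //; apply: le_trans hy.
have -> : x - proj s x = (x - y) - proj s (x - y).
  by rewrite projB py opprB addrA subrK.
exact: (sq_sub_proj_le oE).
Qed.

Lemma esum_finite_le E (f : H -> R) s : (forall e, E e -> 0 <= f e) -> {subset s <= E} -> uniq s ->
  ((\sum_(e <- s) f e)%:E <= \esum_(e in E) (f e)%:E)%E.
Proof.
move=> f0 sE us; apply: esum_ge; exists [set` s].
  by split; [exact: finite_seq|move=> e /= /sE /set_mem].
by rewrite -fsbig_seq// sumEFin.
Qed.

Lemma esum_le_bound E (f : H -> R) (b : \bar R) :
  (forall s, {subset s <= E} -> uniq s -> ((\sum_(e <- s) f e)%:E <= b)%E) ->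
  (\esum_(e in E) (f e)%:E <= b)%E.
Proof.
move=> h; apply: ge_ereal_sup => _ [X [finX XE] <-].
rewrite fsbig_finite//= sumEFin; apply: h; last exact: fset_uniq.
by move=> e; rewrite in_fset_set// => /set_mem/XE/mem_set.
Qed.

(** By [qf_sub_proj], the finite partial sums differ from the value of the form at
    [x] by its value at the remainder, which is nonnegative and arbitrarily small.
    Parseval's identity is the case of the identity operator. *)
Lemma eigen_esum A E x : pos A -> orthonormal_basis E -> E `<=` eigen A ->
  \esum_(e in E) (qf A e * mod2 x e)%:E = (qf A x)%:E.
Proof.
move=> [hA pA] bE eA; have [oE _] := (orthonormal_basisP E).1 bE.
apply/eqP; rewrite eq_le; apply/andP; split.
  apply: esum_le_bound => s sE us.
  by rewrite lee_fin -subr_ge0 -(qf_sub_proj oE x hA eA sE us).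
have [m m0 bA] := qf_bd hA.
apply/lee_addgt0Pr => a a0.
have am : 0 < a / m by rewrite divr_gt0.
have [s [sE us hs]] := dense x bE am.
apply: (@le_trans _ _ ((\sum_(e <- s) qf A e * mod2 x e)%:E + a%:E)%E).
  rewrite -EFinD lee_fin -lerBlDl -(qf_sub_proj oE x hA eA sE us).
  apply: le_trans (bA _) _; rewrite -ler_pdivlMl//; apply: le_trans hs _.
  by rewrite mulrC.
rewrite leeD2r//; apply: esum_finite_le => // e _.
by rewrite mulr_ge0 ?mod2_ge0 ?pA.
Qed.

Lemma parseval E x : orthonormal_basis E -> \esum_(e in E) (mod2 x e)%:E = (sq x)%:E.
Proof.
move=> bE; have [oE _] := (orthonormal_basisP E).1 bE.
rewrite -[RHS](@eigen_esum id E x _ bE).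
- by apply: eq_esum => e Ee; rewrite /qf -/(sq e) (proj1 oE)// mul1r.
- by split=> [|y]; [exact: herm_id|exact: sq_ge0].
- by move=> v _; exists 1; rewrite rscale1.
Qed.

Lemma parseval_scaled E x c : orthonormal_basis E -> 0 <= c ->
  \esum_(e in E) (c * mod2 x e)%:E = (c * sq x)%:E.
Proof.
move=> bE c0.
have -> : c * sq x = sq (rscale (Num.sqrt c) x) by rewrite sqZ sqr_sqrtr.
rewrite -(parseval _ bE); apply: eq_esum => e _.
by rewrite /mod2 !ripZl !exprMn sqr_sqrtr// -mulrDr.
Qed.

(** Let [s] be a finite part of the basis that carries all of the trace but a
    small amount. On the finite linear combinations of the other basis vectors,
    [qf_sum_le] bounds the form by this amount times the squared norm; by density
    this extends to the vectors orthogonal to [s]. The component of a vector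
    along [s] is controlled by the coordinates on [s]. *)
Lemma trace_cptf A : pos A -> (tr A < +oo)%E -> cptf A.
Proof.
move=> pA tA; have [hA p0] := pA; have bE := @onb_basis R H.
have [oE _] := (orthonormal_basisP _).1 bE.
have tA0 : (0 <= tr A)%E by apply: esum_ge0 => e _; rewrite lee_fin; exact: p0.
have tfin : tr A \is a fin_num by rewrite ge0_fin_numE.
move=> d d0.
have d4 : 0 < d / 4 by lra.
have [m m0 bA] := qf_bd hA.
have [_ [X [finX XE] <-]] : exists2 y, [set \sum_(e \in X) (qf A e)%:E | X in fsets (@onb R H)]%E y &
    (tr A - (d / 4)%:E < y)%E.
  by apply: ub_ereal_sup_adherent.
rewrite fsbig_finite//= sumEFin; set s := enum_fset _ => hs.
have us : uniq s by exact: fset_uniq.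
have sE : {subset s <= @onb R H} by move=> e; rewrite in_fset_set// => /set_mem/XE/mem_set.
exists (map (rscale (Num.sqrt (2 * m))) s ++ map (rscale (Num.sqrt (2 * m)) \o J) s) => x.
rewrite ger0_norm ?p0// big_cat !big_map /= -big_split /=.
rewrite (eq_bigr (fun e => 2 * m * mod2 x e)); last first.
  move=> e _; rewrite !ripZr !exprMn sqr_sqrtr; last by rewrite mulr_ge0// ltW.
  by rewrite -mulrDr.
rewrite -mulr_sumr.
pose r := x - proj s x.
have rs e : e \in s -> inner r e = 0.
  by move=> es; rewrite /r linearBl /= (inner_proj_in oE x sE us es) subrr.
have sr : sq r <= sq x by exact: (sq_sub_proj_le oE).
(* r is orthogonal to s: only the basis vectors out of s enter its expansion *)
have qr : qf A r <= d / 2 * sq r.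
  rewrite -subr_le0; apply: (@le0_eps R _ (2 * m)) => [|a a0]; first lra.
  have [g [gE ug hg]] := dense r bE a0.
  pose g' := [seq e <- g | e \notin s].
  have pg : proj g r = proj g' r.
    rewrite /proj big_filter [RHS]big_mkcond /=; apply: eq_bigr => e _.
    by case: ifPn => //; rewrite negbK => /rs ->; rewrite scale0r.
  have g'E : {subset g' <= @onb R H} by move=> e; rewrite mem_filter => /andP[_ /gE].
  have ug' : uniq g' by exact: filter_uniq.
  have sg : \sum_(e <- g') qf A e <= d / 4.
    have : ((\sum_(e <- s ++ g') qf A e)%:E <= tr A)%E.
      apply: esum_finite_le.
      - by move=> e _; exact: p0.
      - by move=> e; rewrite mem_cat => /orP[/sE|/g'E].
      - rewrite cat_uniq us ug' andbT /=; apply/hasPn => e.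
        by rewrite mem_filter => /andP[].
    move: hs; rewrite -(fineK tfin) -EFinB lte_fin lee_fin big_cat /=; lra.
  have q1 : qf A (proj g r) <= d / 4 * sq r.
    rewrite pg; apply: le_trans (qf_sum_le _ _ pA) _.
    apply: ler_pM => //.
    - by apply: sumr_ge0 => e _; exact: p0.
    - by apply: sumr_ge0 => e _; exact: mod2_ge0.
    - by rewrite -subr_ge0 -(sq_sub_proj oE r g'E ug') sq_ge0.
  have := qfD_le (proj g r) (r - proj g r) pA; rewrite addrC subrK => h.
  have := bA (r - proj g r) => h2.
  have : m * sq (r - proj g r) <= m * a by rewrite ler_pM2l.
  lra.
have q2 : qf A (proj s x) <= m * \sum_(e <- s) mod2 x e.
  apply: le_trans (bA _) _; rewrite ler_pM2l//.
  have := sq_sub_proj oE x sE us; have := sq_ge0 (x - proj s x) => h1 h2.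
  have -> : sq (proj s x) = \sum_(e <- s) mod2 x e.
    have : rip (x - proj s x) (proj s x) = 0.
      have -> : x - proj s x = r by [].
      rewrite /proj; elim: (s) (rs) => [|e g IH] hrs; first by rewrite big_nil rip0r.
      rewrite big_cons ripDr IH ?addr0; last by move=> f fg; apply: hrs; rewrite inE fg orbT.
      have /inner0[i1 i2] : inner r e = 0 by apply: hrs; rewrite inE eqxx.
      by rewrite scaleE ripDr !ripZr i1 i2 !mulr0 addr0.
    move: h2; rewrite sqB ripBl -/(sq _); lra.
  by [].
have := qfD_le (proj s x) r pA; rewrite /r [proj s x + _]addrC subrK -/r => h.
have : d / 2 * sq r <= d / 2 * sq x by rewrite ler_pM2l//; lra.
lra.
Qed.

(** Compression by a contraction does not increase the trace of a state. Expanding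
    in a basis [E] of eigenvectors of [A] and exchanging the summations, the trace
    of [Q A Q] becomes the sum over [k] in [E] of [qf A k * sq (Q k)]. Compare
    [Q = P] and [Q = id]. *)
Lemma trace_compress A P : state_op A -> herm P -> (forall x, sq (P x) <= sq x) ->
  (\esum_(e in @onb R H) (qf A (P e))%:E <= 1)%E.
Proof.
move=> [pA kA tA] hP cP; have bO := @onb_basis R H.
have [E bE eA] := eigenbasis (proj1 pA) kA.
have [oE _] := (orthonormal_basisP _).1 bE.
have key (Q : H -> H) : herm Q -> \esum_(e in @onb R H) (qf A (Q e))%:E =
   \esum_(k in E) (qf A k * sq (Q k))%:E.
  move=> hQ.
  transitivity (\esum_(e in @onb R H) \esum_(k in E) (qf A k * mod2 (Q e) k)%:E)%E.
    by apply: eq_esum => e _; rewrite eigen_esum.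
  have nn e k : (0 <= (qf A k * mod2 (Q e) k)%:E)%E.
    by rewrite lee_fin mulr_ge0 ?mod2_ge0//; exact: (proj2 pA).
  rewrite (@esum_esum R _ _ _ (fun _ => E) (fun e k => (qf A k * mod2 (Q e) k)%:E))//.
  rewrite (@reindex_esum R _ _ (E `*`` (fun _ => @onb R H)) _ (fun p => (p.2, p.1))) /=; last first.
    split.
    - by move=> [k e] /= [Ek Oe].
    - by move=> [k e] [k' e'] _ _ /= [-> ->].
    - by move=> [e k] /= [Oe Ek]; exists (k, e).
  rewrite -(@esum_esum R _ _ E (fun _ => @onb R H) (fun k e => (qf A k * mod2 (Q e) k)%:E))//.
  apply: eq_esum => k _.
  have m e : mod2 (Q e) k = mod2 (Q k) e.
    by rewrite mod2C; apply: complexI; rewrite !mod2E herm_inner.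
  under eq_esum do rewrite m.
  by rewrite parseval_scaled//; exact: (proj2 pA).
have := key id herm_id; rewrite -/(tr A).
rewrite tA (key P)// => ->; apply: le_esum => k Ek; rewrite lee_fin.
by apply: ler_wpM2l; [exact: (proj2 pA)|exact: cP].
Qed.
End Bases.

(** * Distances between states *)
Section Distance.
Context {R : realType} {H : hilbertType R}.
Implicit Types (x y z u v w : H) (T A B C S P : H -> H) (a b c d l m : R).

(** The projection onto the line of [x], when [x] is a unit vector. *)
Definition rk x : H -> H := fun y => inner y x *: x.

Lemma rkE x y : rk x y = rscale (rip y x) x + rscale (rip y (J x)) (J x).
Proof. by rewrite /rk innerE scaleE. Qed.
Lemma rip_rk x y z : rip (rk x y) z = rip y x * rip z x + rip y (J x) * rip z (J x).
Proof. by rewrite rkE ripDl !ripZl (ripC x) (ripC (J x)). Qed.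
Lemma qf_rk x y : qf (rk x) y = mod2 y x.
Proof. by rewrite /qf rip_rk /mod2 !expr2. Qed.

Lemma mod2_le x y : sq y = 1 -> mod2 x y <= sq x.
Proof.
move=> y1; have oy : orthoset [set y].
  by split=> [v ->//|v w -> ->].
have := sq_ge0 (x - proj [:: y] x); rewrite (sq_sub_proj oy) ?big_cons ?big_nil ?addr0 ?subr_ge0//.
by move=> v; rewrite inE => /eqP ->; exact: mem_set.
Qed.

Lemma rk_pos x : sq x = 1 -> pos (rk x).
Proof.
move=> x1; split; last by move=> y; rewrite qf_rk mod2_ge0.
split.
- by move=> k y z; rewrite /rk linearDl /= linearZl_LR /= scalerDl scalerA.
- exists 1 => // y; rewrite mul1r /rk sqZc innerE /= x1 mulr1; exact: mod2_le.
- by move=> y z; rewrite [RHS]ripC !rip_rk mulrC [X in _ + X]mulrC.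
Qed.

Lemma rk_cptf x : cptf (rk x).
Proof.
move=> e e0; exists [:: x; J x] => y.
rewrite qf_rk ger0_norm ?mod2_ge0// !big_cons big_nil addr0 -/(mod2 y x).
by rewrite lerDr mulr_ge0 ?sq_ge0 ?ltW.
Qed.

Lemma rk_state x : sq x = 1 -> state_op (rk x).
Proof.
move=> x1; split; [exact: rk_pos|exact: rk_cptf|].
rewrite /tr; under eq_esum do rewrite -[complex.Re _]/(rip _ _) -/(qf _ _) qf_rk mod2C.
by rewrite (parseval _ (@onb_basis R H)) x1.
Qed.

Lemma statesP A : states A <-> state_op A.
Proof.
split=> [[/positive_opP pA _ tA]|[pA kA tA]].
  by split=> //; apply: trace_cptf => //; rewrite tA ltry.
have [hA _] := pA.
split=> //; first exact/positive_opP.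
split; first by case/positive_opP: pA.
by rewrite (absop_eq hA kA pA)// tA ltry.
Qed.

Lemma qf_state_ge A u x : state_op A -> sq u = 1 -> eigen A u -> qf A u * mod2 x u <= qf A x.
Proof.
move=> [[hA pA] _ _] u1 eu.
have ou : orthoset [set u] by split=> [v ->//|v w -> ->].
have := pA (x - proj [:: u] x); rewrite (qf_sub_proj ou)//.
- by rewrite big_cons big_nil addr0 subr_ge0.
- by move=> v ->.
- by move=> v; rewrite inE => /eqP ->; exact: mem_set.
Qed.

Lemma state_eigen_le1 A u : state_op A -> sq u = 1 -> eigen A u -> qf A u <= 1.
Proof.
move=> sA u1 eu; have [[hA pA] _ tA] := sA.
rewrite -lee_fin -tA -[qf A u]mulr1 -u1 -(parseval_scaled _ (@onb_basis R H))//.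
by apply: le_esum => e _; rewrite lee_fin mod2C; exact: qf_state_ge.
Qed.

Lemma state_le1 A x : state_op A -> qf A x <= sq x.
Proof.
move=> sA; have [[hA pA] kA tA] := sA.
have [h|h] := lerP (qf A x) 0; first exact: le_trans h (sq_ge0 _).
have [//||u [c [_ u1 c0 Au hc]]] := top_eigenvector hA kA (@closed_sub_setT R H).
  by exists x.
apply: le_trans (hc x I) _; rewrite ler_piMl ?sq_ge0//.
have -> : c = qf A u by rewrite /qf Au ripZl -/(sq u) u1 mulr1.
by apply: state_eigen_le1 => //; exists c.
Qed.

Lemma state_neq0 A : state_op A -> exists x, 0 < qf A x.
Proof.
move=> [[hA pA] kA tA]; apply: contrapT => h.
have A0 x : qf A x = 0.
  apply/eqP; rewrite eq_le pA andbT leNgt; apply/negP => h2; apply: h; by exists x.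
have : tr A = 0%E by apply: esum1 => e _; rewrite -[complex.Re _]/(qf A e) A0.
by rewrite tA => /eqP; rewrite onee_eq0.
Qed.

Lemma d1C A B : state_op A -> state_op B -> d1 A B = d1 B A.
Proof.
move=> [[hA _] _ _] [[hB _] _ _].
have h1 : herm (A \- B) by exact: hermB.
have h2 : herm (B \- A) by exact: hermB.
rewrite /d1 /trace_norm /absop !adjoint_herm//.
suff -> : (A \- B) \o (A \- B) = (B \- A) \o (B \- A) by [].
apply/funext => x /=.
have lA := herm_lin hA; have lB := herm_lin hB.
rewrite !(linB lA, linB lB) !opprB.
exact: addrC.
Qed.

(** [rk x <= A + m] in the order of self-adjoint operators. *)
Definition rkle x A m := forall y, mod2 y x <= qf A y + m * sq y.

(** If [S := rk x - A] takes a positive value, let [u] be an eigenvector for its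
    largest eigenvalue [l]. The form of [S] is nonpositive on the complement of [u]:
    if it were positive at [z] orthogonal to [u], it would be positive at the
    combination [v] of [u] and [z] that is orthogonal to [x], where it agrees with
    the one of [- A]. So [rk u] splits [S], and the trace of the positive part is [l]. *)
Lemma d1_rk x A : sq x = 1 -> state_op A -> exists l, [/\ 0 <= l, d1 (rk x) A = (2 * l)%:E,
  rkle x A l & l = 0 \/ exists2 u, sq u = 1 & rk x u - A u = rscale l u].
Proof.
move=> x1 sA; have [[hA pA] kA tA] := sA.
have sx := rk_state x1; have [[hx px] kx tx] := sx.
pose S := fun y => rk x y - A y.
have hS : herm S by exact: hermB.
have kS : cptf S by exact: cptfB.
have qS y : qf S y = mod2 y x - qf A y by rewrite /qf /S ripBl -!/(qf _ _) qf_rk.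
have [[y0 hy0]|hn] := pselect (exists y, 0 < qf S y); last first.
  have nS y : qf S y <= 0 by rewrite leNgt; apply/negP => h; apply: hn; exists y.
  have S0 : S 0 = 0 by exact: (lin0 (herm_lin hS)).
  have q0 : qf S 0 = 0 by rewrite /qf S0 rip0l.
  have sp : splits S (fun=> 0).
    split; first split.
    - by move=> k y z; rewrite scaler0 addr0.
    - by exists 1 => // y; rewrite sq0 mulr_ge0 ?sq_ge0.
    - by move=> y z; rewrite rip0l rip0r.
    by split=> // y; rewrite ?q0 ?subr0 ?S0.
  exists 0; split=> //; last by left.
    by rewrite (d1E sx sA sp) q0 esum1// adde0 mulr0.
  by move=> y; have := nS y; rewrite qS mul0r; lra.
have [//||u [l [_ u1 l0 Su hl]]] := top_eigenvector hS kS (@closed_sub_setT R H).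
  by exists y0.
have hu := proj1 (rk_pos u1).
have qu : qf S u = l by rewrite /qf Su ripZl -/(sq u) u1 mulr1.
have sp : splits S (rk u).
  split=> //; split.
  - by move=> y; rewrite /rk linearZl_LR /= inner_sq u1 mulr1.
  - move=> y; have lS := herm_lin hS.
    rewrite !rkE !(herm_sa hS) (linD lS) !(linR lS) (linJ lS) Su JZ !ripZr !rscaleA.
    by congr (rscale _ _ + rscale _ _); exact: mulrC.
  - by move=> y; rewrite /rk qf_inner// qu mulr_ge0 ?mod2_ge0// ltW.
  - move=> y; set z := y - rk u y; rewrite leNgt; apply/negP => qz.
    have zu : inner z u = 0 by rewrite /z linearBl /= linearZl_LR /= inner_sq u1 mulr1 subrr.
    pose v := inner z x *: u - inner u x *: z.
    have vx : mod2 v x = 0.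
      by apply/mod2_eq0; rewrite /v linearBl /= !linearZl_LR /= mulrC subrr.
    have : qf S v <= 0 by rewrite qS vx sub0r oppr_le0.
    have uz : rip (S (inner z x *: u)) (inner u x *: z) = 0.
      rewrite (linZ (herm_lin hS)) Su /rip !linearZl_LR linearZr_LR /= (innerC u z) zu.
      by rewrite conjc0 !mulr0.
    rewrite /v qfB// uz !qf_inner// qu mulr0 subr0 => h.
    have m1 := mod2_ge0 z x; have m2 := mod2_ge0 u x.
    have : 0 <= mod2 z x * l by rewrite mulr_ge0// ltW.
    have : mod2 u x <= 0.
      rewrite leNgt; apply/negP => m3.
      have : 0 < mod2 u x * qf S z by rewrite mulr_gt0.
      have : 0 <= mod2 z x * l by rewrite mulr_ge0// ltW.
      lra.
    by have := qu; rewrite qS; have := pA u; lra.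
exists l; split=> //; first exact: ltW.
- rewrite (d1E sx sA sp).
  have -> : \esum_(e in @onb R H) (qf S (rk u e))%:E = l%:E.
    under eq_esum do rewrite /rk qf_inner// qu mulrC mod2C.
    by rewrite (parseval_scaled _ (@onb_basis R H)) ?(ltW l0)// u1 mulr1.
  by rewrite -EFinD; congr EFin; lra.
- by move=> y; have := hl y I; rewrite qS; lra.
- by right; exists u.
Qed.

Lemma d1_rk_le x A l m : sq x = 1 -> state_op A -> d1 (rk x) A = (2 * l)%:E -> 0 <= m ->
  rkle x A m <-> l <= m.
Proof.
move=> x1 sA; have [l' [l0 -> le' lu]] := d1_rk x1 sA => -[ll] m0.
have {ll} -> : l = l' by lra.
split=> [h|lm y]; last first.
  by apply: le_trans (le' y) _; rewrite lerD2l ler_wpM2r ?sq_ge0.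
case: lu => [->//|[u u1 hu]].
have := h u; have : rip (rk x u - A u) u = l' by rewrite hu ripZl -/(sq u) u1 mulr1.
rewrite ripBl -!/(qf _ _) qf_rk u1; lra.
Qed.

Lemma d1_rk_eq x y A B m : sq x = 1 -> sq y = 1 -> state_op A -> state_op B ->
  d1 (rk x) A = d1 (rk y) B -> 0 <= m -> rkle x A m <-> rkle y B m.
Proof.
move=> x1 y1 sA sB e m0; have [l [_ dl _ _]] := d1_rk x1 sA.
have h := d1_rk_le x1 sA dl m0; rewrite e in dl; have h' := d1_rk_le y1 sB dl m0.
by split=> [/h/h'|/h'/h].
Qed.

(** Taking the inner products of [rk x u - rk y u = l u] with [x] and [y] gives a
    homogeneous linear system in [inner u x] and [inner u y]. If [l != 0] these are
    not both 0, so the determinant of the system vanishes, which is the claim. *)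
Lemma d1_rk_rk x y : sq x = 1 -> sq y = 1 ->
  exists2 l, d1 (rk x) (rk y) = (2 * l)%:E & l ^+ 2 = 1 - mod2 x y.
Proof.
move=> x1 y1; have [l [l0 dl hl hu]] := d1_rk x1 (rk_state y1).
exists l => //.
have [l00|lN0] := eqVneq l 0.
  have := hl x; rewrite l00 mul0r addr0 mod2xx x1 qf_rk expr1n.
  have := mod2_le x y1; rewrite x1 expr0n /=; lra.
case: hu => [l00|[u u1 hu]]; first by rewrite l00 eqxx in lN0.
have lp : 0 < l by rewrite lt_neqAle eq_sym lN0.
set p := inner u x; set q := inner u y; set c := inner x y.
have e1 : p - q * c^*%C = l%:C%C * p.
  have := congr1 (inner ^~ x) hu; rewrite /= linearBl /= !linearZl_LR /=.
  by rewrite inner_sq x1 mulr1 (innerC y x).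
have e2 : p * c - q = l%:C%C * q.
  have := congr1 (inner ^~ y) hu; rewrite /= linearBl /= !linearZl_LR /=.
  by rewrite inner_sq y1 mulr1.
have m2 : (mod2 x y)%:C%C = c * c^*%C by rewrite mod2E sqr_normc.
have lC : l%:C%C != 0 by apply/eqP => -[]; lra.
have lC1 : l%:C%C + 1 != 0 by apply/eqP => -[]; lra.
have [p0|p0] := eqVneq p 0.
  have q0 : q = 0.
    by apply/eqP; have := e2; rewrite p0 mul0r sub0r => /eqP; rewrite eq_sym -subr_eq0 opprK -{2}[q]mul1r -mulrDl mulf_eq0 (negPf lC1).
  have : rscale l u = 0 by rewrite -hu /rk -/p -/q p0 q0 !scale0r subr0.
  by move/(congr1 sq); rewrite sqZ u1 sq0 mulr1 => /eqP; rewrite sqrf_eq0 (negPf lN0).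
have [q0|q0] := eqVneq q 0.
  have c0 : c = 0.
    by apply/eqP; have := e2; rewrite q0 mulr0 subr0 => /eqP; rewrite mulf_eq0 (negPf p0).
  have l1 : l%:C%C = 1.
    by apply: (mulIf p0); rewrite -e1 q0 mul0r subr0 mul1r.
  have -> : mod2 x y = 0 by apply/mod2_eq0.
  by case: l1 => ->; rewrite expr1n subr0.
apply: complexI; rewrite rmorphB rmorph1 rmorphXn /= m2.
have pq : p * q != 0 by rewrite mulf_neq0.
apply: (mulIf pq).
have e1' : q * c^*%C = p - l%:C%C * p by rewrite -e1 opprB addrC subrK.
have e2' : p * c = q + l%:C%C * q by rewrite -e2 addrC subrK.
have -> : (1 - c * c^*%C) * (p * q) = p * q - (p * c) * (q * c^*%C) by ring.
by rewrite e1' e2'; ring.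
Qed.

Lemma d1_rk_mod2 x y z w : sq x = 1 -> sq y = 1 -> sq z = 1 -> sq w = 1 ->
  d1 (rk x) (rk y) = d1 (rk z) (rk w) -> mod2 x y = mod2 z w.
Proof.
move=> x1 y1 z1 w1; have [l -> hl] := d1_rk_rk x1 y1; have [l' -> hl'] := d1_rk_rk z1 w1.
move=> h; have ll : 2 * l = 2 * l' by case: h.
have e : l = l' by lra.
by rewrite e in hl; lra.
Qed.

Lemma d1_rk2 x A : sq x = 1 -> state_op A -> d1 (rk x) A = 2%:E <-> A x = 0.
Proof.
move=> x1 sA; have [[hA pA] kA tA] := sA.
have [l [l0 dl hl hu]] := d1_rk x1 sA; rewrite dl.
have lu : l = 0 \/ exists u, [/\ sq u = 1, rk x u - A u = rscale l u & l = mod2 u x - qf A u].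
  case: hu => [->|[u u1 hu]]; [by left|right; exists u; split => //].
  have : rip (rk x u - A u) u = l by rewrite hu ripZl -/(sq u) u1 mulr1.
  by rewrite ripBl -!/(qf _ _) qf_rk.
split.
  move=> -[l2]; have l1 : l = 1 by lra.
  case: lu => [l00|[u [u1 uu lm]]]; first by exfalso; lra.
  have m1 := mod2_le u x1; have qu := pA u.
  have Au : A u = 0.
    by apply: (psd_eq0 hA (@closed_sub_setT R H)) => //; lra.
  move: uu; rewrite Au subr0 l1 rscale1 => uu.
  have k0 : inner u x != 0.
    by apply/eqP => k0; move: uu; rewrite /rk k0 scale0r => u0; move: u1; rewrite -u0 sq0; lra.
  have : inner u x *: A x = 0 by rewrite -(linZ (herm_lin hA)) -/(rk x u) uu.
  by move/eqP; rewrite scaler_eq0 (negPf k0) => /eqP.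
move=> Ax; congr EFin.
have := hl x; rewrite mod2xx x1 expr1n /qf Ax rip0l mulr1 add0r => l1.
case: lu => [l00|[u [u1 _ lm]]]; first by exfalso; lra.
by have := mod2_le u x1; have := pA u; lra.
Qed.

(** Distance 2 means that the positive part [P (A - B) P] of [A - B] has trace 1.
    The trace of [P A P] being at most 1, the one of [P B P] is 0. *)
Lemma d1_orth_half A B P : state_op A -> state_op B -> d1 A B = 2%:E ->
  splits (fun x => A x - B x) P -> (forall x, sq (P x) <= sq x) -> forall y, B (P y) = 0.
Proof.
move=> sA sB dAB sp cP; have [[hA pA] kA tA] := sA; have [[hB pB] kB tB] := sB.
have [hP [PP PS pP nP]] := sp.
have := d1E sA sB sp; rewrite dAB; set t := \esum_(e in _) _ => tt.
have t1 : t = 1%E.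
  case: t tt => [t||]//= -[tt]; congr EFin; lra.
have tB0 : (\esum_(e in @onb R H) (qf B (P e))%:E <= 0)%E.
  have : (t + \esum_(e in @onb R H) (qf B (P e))%:E <= 1)%E.
    rewrite /t -esumD; last 2 first.
    - by move=> e _; rewrite lee_fin; exact: pP.
    - by move=> e _; rewrite lee_fin; exact: pB.
    apply: le_trans (trace_compress sA hP cP); apply: le_esum => e _.
    by rewrite -EFinD lee_fin {1}/qf ripBl -!/(qf _ _) subrK.
  by rewrite t1 -leeBrDl// subee.
have BP e : onb e -> B (P e) = 0.
  move=> Oe; apply: (psd_eq0 hB (@closed_sub_setT R H)) => //.
  apply/eqP; rewrite eq_le pB andbT -lee_fin; apply: le_trans tB0.
  have := @esum_finite_le R H onb (fun e => qf B (P e)) [:: e] (fun e _ => pB _).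
  rewrite big_cons big_nil addr0; apply => //.
  by move=> v; rewrite inE => /eqP ->; exact: mem_set.
have PB y : P (B y) = 0.
  apply: (proj2 ((orthonormal_basisP _).1 (@onb_basis R H))) => e Oe.
  by rewrite !herm_inner// BP// linear0r.
by move=> y; apply: eq_rip => z; rewrite (herm_sa hB) (herm_sa hP) PB rip0r rip0l.
Qed.

(** By [d1_orth_half] for [A - B] and for [B - A], the operator [B] vanishes on
    the range of [P] and [A] on the one of [1 - P]. An eigenvector of [A] with a
    nonzero eigenvalue belongs to the former. *)
Lemma d1_orth A B e a : state_op A -> state_op B -> d1 A B = 2%:E ->
  0 < a -> A e = rscale a e -> B e = 0.
Proof.
move=> sA sB dAB a0 Ae; have [[hA pA] kA tA] := sA; have [[hB pB] kB tB] := sB.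
have hS := hermB hA hB; have kS := cptfB hA hB kA kB.
have [P sp cP] := jordan hS kS.
have [hP [PP PS pP nP]] := sp.
have BP := d1_orth_half sA sB dAB sp cP.
pose Q := fun x => x - P x.
have oPQ x : rip (P x) (x - P x) = 0 by rewrite (herm_sa hP) (linB (herm_lin hP)) PP subrr rip0r.
have spQ : splits (fun x => B x - A x) Q.
  have hQ : herm Q by apply: hermB => //; exact: herm_id.
  have QQ x : Q (Q x) = Q x.
    by rewrite /Q (linB (herm_lin hP)) PP subrr subr0.
  have qN x : qf (fun x => B x - A x) x = - qf (fun x => A x - B x) x.
    by rewrite /qf -ripNl opprB.
  split=> //; split=> // x.
  - rewrite /Q -(opprB (A x)) (linN (herm_lin hP)) PS opprK.
    rewrite (linB (herm_lin hA)) (linB (herm_lin hB)).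
    by apply: eq_rip => z; rewrite !(ripBl, ripDl, ripNl); ring.
  - by have := nP x; rewrite qN /Q; lra.
  - by have := pP x; rewrite qN /Q subKr; lra.
have cQ x : sq (Q x) <= sq x.
  rewrite /Q; have := oPQ x; rewrite ripBr => h; rewrite sqB ripC.
  have := sq_ge0 (P x); rewrite /sq in h *; lra.
have AQ := d1_orth_half sB sA (etrans (d1C sB sA) dAB) spQ cQ.
have hQ := proj1 spQ.
have QA y : Q (A y) = 0.
  by apply: eq_rip => z; rewrite (herm_sa hQ) (herm_sa hA) AQ rip0r rip0l.
have Qe : Q e = 0.
  have := QA e; rewrite Ae (linR (herm_lin hQ)) => /(congr1 (rscale a^-1)).
  by rewrite rscaleA mulVf ?gt_eqF// rscale1 rscale0.
by have := BP e; move/eqP: Qe; rewrite subr_eq0 => /eqP <-.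
Qed.

(** Reading distance 2 as orthogonality, the double orthogonal complement of [A]
    is reduced to [A]. *)
Definition metric_pure A := forall C, state_op C ->
  (forall B, state_op B -> d1 A B = 2%:E -> d1 C B = 2%:E) -> C = A.

(** A state [C] that satisfies the hypothesis is at distance 2 from [rk y] for all
    unit vectors [y] orthogonal to [x], so that it vanishes on the complement of
    [x], and it is [rk x] since it has trace 1. *)
Lemma rk_metric_pure x : sq x = 1 -> metric_pure (rk x).
Proof.
move=> x1 C sC hC; have [[hH pC] kC tC] := sC; have lC := herm_lin hH.
have Cy y : inner y x = 0 -> C y = 0.
  move=> yx; have [y0|y0] := eqVneq (sq y) 0.
    by rewrite (sq_eq0 y0) (lin0 lC).
  pose z := rscale (Num.sqrt (sq y))^-1 y.
  have z1 : sq z = 1 by exact: sq_normalize.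
  have : d1 C (rk z) = 2%:E.
    apply: hC; first exact: rk_state.
    apply/(d1_rk2 x1 (rk_state z1)).
    by rewrite /rk /z /rscale linearZr_LR /= (innerC x) yx conjc0 mulr0 scale0r.
  rewrite d1C//; last exact: rk_state.
  move/(d1_rk2 z1 sC); rewrite /z (linR lC) => /(congr1 (rscale (Num.sqrt (sq y)))).
  rewrite rscaleA mulfV ?rscale1 ?rscale0//.
  by rewrite sqrtr_eq0 -ltNge lt_neqAle eq_sym y0 sq_ge0.
have ox y : inner (y - rk x y) x = 0.
  by rewrite linearBl /= linearZl_LR /= inner_sq x1 mulr1 subrr.
have Cx : C x = rscale (qf C x) x.
  have w0 : C x - rk x (C x) = 0.
    set w := C x - _; apply: sq_eq0.
    have : rip w (C x) = 0 by rewrite -(herm_sa hH) Cy ?rip0l// ox.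
    have /inner0[i1 i2] : inner w x = 0 by exact: ox.
    by rewrite /sq {3}/w ripBr => ->; rewrite sub0r /rk scaleE ripDr !ripZr i1 i2 !mulr0 addr0 oppr0.
  move/eqP: w0; rewrite subr_eq0 => /eqP {1}->; rewrite rkE.
  have -> : rip (C x) (J x) = 0 by exact: ripAJ.
  by rewrite rscale0l addr0.
have CE y : C y = rscale (qf C x) (rk x y).
  rewrite -{1}(subrK (rk x y) y) (linD lC) Cy// add0r /rk (linZ lC) Cx.
  by rewrite /rscale !scalerA mulrC.
have q1 : qf C x = 1.
  have : tr C = (qf C x)%:E.
    rewrite -[qf C x]mulr1 -x1 -(parseval_scaled _ (@onb_basis R H))//.
    apply: eq_esum => e _; congr EFin.
    by rewrite -[complex.Re _]/(rip _ _) CE ripZl -/(qf _ _) qf_rk mod2C.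
  by rewrite tC => -[].
by apply/funext => y; rewrite CE q1 rscale1.
Qed.

(** The projection onto an eigenvector [u] for the largest eigenvalue of [A] is
    at distance 2 from all the states orthogonal to [A], by [d1_orth]. *)
Lemma metric_pure_rk A : state_op A -> metric_pure A -> exists2 x, sq x = 1 & A = rk x.
Proof.
move=> sA mA; have [[hA pA] kA tA] := sA.
have [x Ax] := state_neq0 sA.
have [//||u [a [_ u1 a0 Au _]]] := top_eigenvector hA kA (@closed_sub_setT R H).
  by exists x.
exists u => //; apply/esym/mA; first exact: rk_state.
move=> B sB dAB; apply/(d1_rk2 u1 sB).
exact: (d1_orth sA sB dAB a0 Au).
Qed.

(** Let [V A B] be the set of common eigenvectors with common eigenvalues. If
    one of the forms took a positive value on the complement of [V A B], let [c] be
    the largest of the top eigenvalues of [A] and [B] there and [u] an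
    eigenvector for it, say of [A]. Then [rk u <= A + (1 - c)] since [c <= 1], so
    that [rk u <= B + (1 - c)]; at [u], this gives a value at least [c] of the form
    of [B], which is at most [c] on the complement. So [u] is also an eigenvector
    of [B], and [u] is in [V A B], a contradiction. Therefore both
    operators vanish on the complement, which is thus contained in [V A B]. *)
Lemma rkle_determines A B : pos A -> cptf A -> (forall x, qf A x <= sq x) ->
  pos B -> cptf B -> (forall x, qf B x <= sq x) ->
  (forall x m, sq x = 1 -> 0 <= m -> rkle x A m <-> rkle x B m) -> A = B.
Proof.
pose V A B := [set v : H | exists c, A v = rscale c v /\ B v = rscale c v].
have VC A' B' : V A' B' = V B' A'.
  by apply/seteqP; split=> v [c [h1 h2]]; exists c.
(* the contradiction, with the roles of the two operators left open *)
have key A' B' u c : pos A' -> pos B' -> (forall x, qf A' x <= sq x) ->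
  (forall x m, sq x = 1 -> 0 <= m -> rkle x A' m -> rkle x B' m) ->
  orth (V A' B') u -> sq u = 1 -> A' u = rscale c u ->
  (forall y, orth (V A' B') y -> qf B' y <= c * sq y) -> False.
  move=> [hA pA] [hB pB] lA le ou u1 Au hc.
  have qu : qf A' u = c by rewrite /qf Au ripZl -/(sq u) u1 mulr1.
  have c1 : c <= 1 by have := lA u; rewrite qu u1.
  have lu : rkle u A' (1 - c).
    move=> y; have ou1 : orthoset [set u] by split=> [v ->//|v w -> ->].
    have us : {subset [:: u] <= [set u]} by move=> v; rewrite inE => /eqP ->; exact: mem_set.
    have := pA (y - proj [:: u] y); rewrite (qf_sub_proj ou1 y hA _ us)//; last by move=> v ->; exists c.
    have := sq_sub_proj ou1 y us isT.
    have := sq_ge0 (y - proj [:: u] y); rewrite !big_cons !big_nil !addr0 qu.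
    set s := sq (_ - _); set m := mod2 y u => s0 hs h.
    have -> : sq y = s + m by lra.
    have : 0 <= (1 - c) * s by rewrite mulr_ge0// subr_ge0.
    lra.
  have := le u (1 - c) u1 ltac:(by rewrite subr_ge0) lu u.
  rewrite mod2xx u1 expr1n mulr1 => hb.
  have hV : V A' B' `<=` eigen B' by move=> v [d [_ h]]; exists d.
  pose D := fun x => rscale c x - B' x.
  have hD : herm D by apply: hermB => //; apply: hermZ; exact: herm_id.
  have qD x : qf D x = c * sq x - qf B' x by rewrite /qf /D ripBl ripZl.
  have cM := closed_sub_orth (V A' B').
  have Du : D u = 0.
    apply: (psd_eq0 hD cM) => //.
    - move=> x Mx.
      exact: (csubB cM (csubZ cM _ Mx) (orth_eigen_invariant hB hV Mx)).
    - by move=> x Mx; rewrite qD subr_ge0 hc.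
    - by rewrite qD u1 mulr1; have := hc _ ou; rewrite u1 mulr1; lra.
  have Vu : V A' B' u by exists c; split=> //; apply/esym/eqP; rewrite -subr_eq0; apply/eqP.
  by have := orthP ou Vu; rewrite -/(sq u) u1; lra.
move=> pA kA lA pB kB lB le.
have [hA qA] := pA; have [hB qB] := pB.
have cM := closed_sub_orth (V A B).
have iA x : orth (V A B) x -> orth (V A B) (A x).
  by apply: orth_eigen_invariant => // v [d [h _]]; exists d.
have iB x : orth (V A B) x -> orth (V A B) (B x).
  by apply: orth_eigen_invariant => // v [d [_ h]]; exists d.
have leA x m : sq x = 1 -> 0 <= m -> rkle x A m -> rkle x B m by move=> x1 m0 /(le _ _ x1 m0).
have leB x m : sq x = 1 -> 0 <= m -> rkle x B m -> rkle x A m by move=> x1 m0 /(le _ _ x1 m0).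
have topA := top_eigenvector hA kA cM iA.
have topB := top_eigenvector hB kB cM iB.
have keyA u c := key A B u c pA pB lA leA.
have keyB u c : _ := key B A u c pB pA lB leB.
rewrite -VC in keyB.
have nA : ~ exists2 x, orth (V A B) x & 0 < qf A x.
  move=> eA; have [u [a [ou u1 a0 Au ha]]] := topA eA.
  have [eB|nB] := pselect (exists2 x, orth (V A B) x & 0 < qf B x).
    have [v [b [ov v1 b0 Bv hb]]] := topB eB.
    have [ab|ba] := lerP a b.
      apply: (keyB v b) => // y oy; apply: le_trans (ha _ oy) _.
      by rewrite ler_wpM2r ?sq_ge0.
    apply: (keyA u a) => // y oy; apply: le_trans (hb _ oy) _.
    by rewrite ler_wpM2r ?sq_ge0// ltW.
  apply: (keyA u a) => // y oy; apply: (@le_trans _ _ 0).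
    by rewrite leNgt; apply/negP => h; apply: nB; exists y.
  by rewrite mulr_ge0 ?sq_ge0 ?ltW.
have nB : ~ exists2 x, orth (V A B) x & 0 < qf B x.
  move=> eB; have [v [b [ov v1 b0 Bv hb]]] := topB eB.
  apply: (keyB v b) => // y oy; apply: (@le_trans _ _ 0).
    by rewrite leNgt; apply/negP => h; apply: nA; exists y.
  by rewrite mulr_ge0 ?sq_ge0 ?ltW.
have M0 x : orth (V A B) x -> x = 0.
  move=> ox.
  have A0 : A x = 0.
    apply: (psd_eq0 hA cM) => //; apply/eqP; rewrite eq_le qA andbT leNgt; apply/negP => h.
    by apply: nA; exists x.
  have B0 : B x = 0.
    apply: (psd_eq0 hB cM) => //; apply/eqP; rewrite eq_le qB andbT leNgt; apply/negP => h.
    by apply: nB; exists x.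
  have Vx : V A B x by exists 0; rewrite rscale0l.
  by apply: sq_eq0; exact: (orthP ox Vx).
apply/funext => x; apply/eqP; rewrite -subr_eq0; apply/eqP/M0 => v [c [Av Bv]].
by rewrite linearBl /= !herm_inner// Av Bv subrr.
Qed.
End Distance.

(** * Wigner's theorem *)
Section Wigner.
Context {R : realType} {H : hilbertType R}.
Implicit Types (x y z u v w : H) (k : R[i]) (a b c d l m s : R).

Definition abs2 k : R := complex.Re k ^+ 2 + complex.Im k ^+ 2.

Lemma abs2E k : (abs2 k)%:C%C = `|k| ^+ 2.
Proof. by rewrite -add_Re2_Im2. Qed.
Lemma mod2Zl k x y : mod2 (k *: x) y = abs2 k * mod2 x y.
Proof. by apply: complexI; rewrite rmorphM /= !mod2E abs2E linearZl_LR /= normrM exprMn. Qed.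
Lemma mod2Zr k x y : mod2 x (k *: y) = abs2 k * mod2 x y.
Proof. by rewrite mod2C mod2Zl mod2C. Qed.

Lemma mod2_eq_sq x y : mod2 x x = mod2 y y -> sq x = sq y.
Proof.
rewrite !mod2xx => /eqP; rewrite eqrXn2 ?sq_ge0// => /eqP //.
Qed.

Lemma cauchy_schwarz_eq x y : mod2 x y = sq x * sq y -> x <> 0 -> exists k, y = k *: x.
Proof.
move=> e x0.
have sx : sq x != 0 by apply/eqP => /sq_eq0.
exists ((sq x)^-1%:C%C * inner y x).
apply/eqP; rewrite -subr_eq0; apply/eqP/sq_eq0.
rewrite -scalerA -/(rscale _ _) sqB sqZ ripZr rip_inner sqZc innerE /= -/(mod2 y x) mod2C e.
by field.
Qed.

(** The squared norm of the difference of the two sides is a combination of inner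
    products of values of [T], thus equal to the one of
    [(rscale a x + y) - (rscale a x + y)]. *)
Lemma isometry_linear (T : H -> H) (W : set H) a x y :
  (forall x y, W x -> W y -> rip (T x) (T y) = rip x y) ->
  W x -> W y -> W (rscale a x + y) -> T (rscale a x + y) = rscale a (T x) + T y.
Proof.
move=> iT Wx Wy Wv; apply/eqP; rewrite -subr_eq0; apply/eqP/sq_eq0.
set v := rscale a x + y in Wv *.
rewrite /sq !(ripBl, ripBr, ripDl, ripDr, ripZl, ripZr) !iT//.
by rewrite /v !(ripDl, ripDr, ripZl, ripZr) (ripC y x); ring.
Qed.

Lemma orthE v w : inner w v = 0 ->
  [/\ rip w v = 0, rip w (J v) = 0, rip v w = 0 & rip v (J w) = 0].
Proof.
move/inner0 => [h1 h2]; split=> //; first by rewrite ripC.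
by rewrite ripC ripJl h2 oppr0.
Qed.

(** On an affine hyperplane [v + W], with [W] the complement of [v], the moduli of
    the inner products determine their real parts, once they are known on [W]. *)
Lemma mod2_affine v w z : sq v = 1 -> inner w v = 0 -> inner z v = 0 ->
  mod2 (v + w) (v + z) = 1 + 2 * rip w z + mod2 w z.
Proof.
move=> v1 /orthE[w1 w2 w3 w4] /orthE[z1 z2 z3 z4].
rewrite /mod2 JD !(ripDl, ripDr) -/(sq v) v1 ripxJ w1 w2 z3 z4; ring.
Qed.

Lemma rip_decomp v w z a b c d : sq v = 1 -> inner w v = 0 -> inner z v = 0 ->
  rip (rscale a v + rscale b (J v) + w) (rscale c v + rscale d (J v) + z) =
  a * c + b * d + rip w z.
Proof.
move=> v1 /orthE[w1 w2 w3 w4] /orthE[z1 z2 z3 z4].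
rewrite !(ripDl, ripDr, ripZl, ripZr) ripJJ ripxJ (ripC (J v) v) ripxJ (ripC (J v) z).
rewrite -/(sq v) v1 w1 w2 z2 z3; ring.
Qed.

Lemma J_decomp v w a b s : s * s = 1 ->
  rscale s (J (rscale a v + rscale (s * b) (J v) + w)) =
  rscale (- b) v + rscale (s * a) (J v) + rscale s (J w).
Proof.
move=> ss; rewrite !JD !JZ JJ !rscaleDr !rscaleA mulrA ss mul1r; congr (_ + _).
by rewrite addrC [rscale b _]scalerN -/(rscale b v) -rscaleN.
Qed.

(** Unitary and antiunitary maps at once: [s] tells the complex linear maps from
    the conjugate-linear ones. *)
Record semiunitary (U : H -> H) s : Prop := Semiunitary {
  su_sign : s = 1 \/ s = - 1;
  su_rip : forall x y, rip (U x) (U y) = rip x y;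
  su_J : forall x, U (J x) = rscale s (J (U x));
  su_surj : forall y, exists x, y = U x }.

(** Let [f] preserve the moduli of inner products, and fix a unit vector [e], with
    complement [W]. The phases are fixed by the requirement that the image [g (e + w)]
    of [e + w] has component 1 along [e' := f e], that is,
    [g (e + w) = e' + T w] with [T w] orthogonal to [e']. This makes [T] preserve
    real parts of inner products ([rip_T]), so that it is real linear, and
    it is either complex linear or conjugate-linear ([T_J]). The map [U] sends
    [e] to [e'] and extends [T]. *)
Section RayMap.
Variables (f : H -> H) (e : H).
Hypothesis e1 : sq e = 1.
Hypothesis fm : forall x y, mod2 (f x) (f y) = mod2 x y.
Hypothesis fs : forall y, exists x k, y = k *: f x.

Let e' := f e.
Lemma sq_ray x : sq (f x) = sq x.
Proof. exact/mod2_eq_sq/fm. Qed.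
Lemma sq_e' : sq e' = 1. Proof. by rewrite sq_ray. Qed.

Let g x := (inner (f x) e')^-1 *: f x.
Let W : set H := [set w | inner w e = 0].
Let T w := g (e + w) - e'.

Lemma W_closed : closed_sub W.
Proof.
have -> : W = orth [set e] by apply/seteqP; split=> [x h v ->//|x]; exact.
exact: closed_sub_orth.
Qed.
Lemma inner_eD w : W w -> inner (e + w) e = 1.
Proof. by move=> Ww; rewrite linearDl /= Ww addr0 inner_sq e1. Qed.
Lemma sq_eD w : W w -> sq (e + w) = 1 + sq w.
Proof. by move=> /orthE[w1 _ w3 _]; rewrite sqD w3 e1 mulr0 addr0. Qed.

Lemma abs2_phase w : W w -> abs2 (inner (f (e + w)) e')^-1 = 1.
Proof.
move=> Ww; apply: complexI; rewrite abs2E normrV ?unitfE; last first.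
  apply/eqP => /mod2_eq0; rewrite fm.
  by apply/eqP; rewrite -(inj_eq (@complexI R)) mod2E inner_eD// normr1 expr1n oner_eq0.
by rewrite exprVn -mod2E fm mod2E inner_eD// normr1 expr1n invr1.
Qed.

Lemma inner_g w : W w -> inner (g (e + w)) e' = 1.
Proof.
move=> Ww; rewrite linearZl_LR /= mulVf//; apply/eqP => /mod2_eq0; rewrite fm.
by apply/eqP; rewrite -(inj_eq (@complexI R)) mod2E inner_eD// normr1 expr1n oner_eq0.
Qed.

Lemma T_orth w : W w -> inner (T w) e' = 0.
Proof. by move=> Ww; rewrite linearBl /= inner_g// inner_sq sq_e' subrr. Qed.

Lemma g_T w : g (e + w) = e' + T w.
Proof. by rewrite [RHS]addrC subrK. Qed.

Lemma mod2_gf z w : W w -> mod2 z (g (e + w)) = mod2 z (f (e + w)).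
Proof. by move=> Ww; rewrite mod2Zr abs2_phase// mul1r. Qed.

Lemma mod2_gg z w : W z -> W w -> mod2 (g (e + z)) (g (e + w)) = mod2 (e + z) (e + w).
Proof. by move=> Wz Ww; rewrite mod2_gf// mod2C mod2_gf// mod2C fm. Qed.

Lemma sq_T w : W w -> sq (T w) = sq w.
Proof.
move=> Ww; have : sq (e' + T w) = sq (e + w).
  by apply: mod2_eq_sq; rewrite -g_T mod2_gg.
rewrite sq_eD// sqD sq_e'; have [_ _ -> _] := orthE (T_orth Ww); lra.
Qed.

(** Since [f w] is orthogonal to [e'], its inner product with [g (e + z)] is the
    one with [T z]. *)
Lemma mod2_fT w z : W w -> W z -> mod2 (f w) (T z) = mod2 w z.
Proof.
move=> Ww Wz.
have fw : inner (f w) e' = 0 by apply/mod2_eq0; rewrite fm; apply/mod2_eq0.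
have := mod2_gf (f w) Wz; rewrite fm g_T.
have -> : mod2 (f w) (e' + T z) = mod2 (f w) (T z).
  by rewrite mod2C addrC mod2Dl0 1?mod2C// innerC fw conjc0.
move=> ->; rewrite mod2C addrC mod2Dl0 1?mod2C//.
by rewrite innerC Ww conjc0.
Qed.

Lemma T_ray w : W w -> exists k, T w = k *: f w.
Proof.
move=> Ww; have [f0|f0] := pselect (f w = 0).
  by exists 0; rewrite scale0r; apply: sq_eq0; rewrite sq_T// -sq_ray f0 sq0.
apply: cauchy_schwarz_eq => //.
by rewrite mod2_fT// mod2xx sq_ray sq_T.
Qed.

Lemma mod2_T w z : W w -> W z -> mod2 (T w) (T z) = mod2 w z.
Proof.
move=> Ww Wz; rewrite -[RHS](mod2_fT Ww Wz); have [k Tk] := T_ray Ww.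
have [w0|w0] := eqVneq (sq w) 0.
  have -> : T w = 0 by apply: sq_eq0; rewrite sq_T.
  by have -> : f w = 0 by apply: sq_eq0; rewrite sq_ray.
rewrite Tk mod2Zl.
have : sq (T w) = abs2 k * sq (f w) by rewrite Tk sqZc.
rewrite sq_T// sq_ray -{1}[sq w]mul1r => /(mulIf w0) <-.
by rewrite mul1r.
Qed.

(** Compare the moduli of [1 + inner w z] and [1 + inner (T w) (T z)]. *)
Lemma rip_T w z : W w -> W z -> rip (T w) (T z) = rip w z.
Proof.
move=> Ww Wz; have := mod2_gg Ww Wz.
rewrite !g_T (mod2_affine sq_e' (T_orth Ww) (T_orth Wz)) (mod2_affine e1 Ww Wz) mod2_T//; lra.
Qed.

Lemma W_add w z : W w -> W z -> W (w + z). Proof. exact: (csubD W_closed). Qed.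
Lemma W_scale a w : W w -> W (rscale a w). Proof. exact: (csubZ W_closed). Qed.
Lemma W_J w : W w -> W (J w). Proof. exact: (csubZ W_closed). Qed.
Lemma T_lin a w z : W w -> W z -> T (rscale a w + z) = rscale a (T w) + T z.
Proof. by move=> Ww Wz; apply: (isometry_linear rip_T) => //; apply: W_add => //; exact: W_scale. Qed.
Lemma T_add w z : W w -> W z -> T (w + z) = T w + T z.
Proof. by move=> Ww Wz; have := T_lin 1 Ww Wz; rewrite !rscale1. Qed.

(** [T (J w)] has the norm of [w], and its inner product with [T w] has modulus
    [sq w] and real part 0: the Cauchy-Schwarz inequality is an equality. *)
Lemma T_J_sign w : W w -> T (J w) = J (T w) \/ T (J w) = - J (T w).
Proof.
move=> Ww; have WJw := W_J Ww.
have : mod2 (T (J w)) (T w) = sq w ^+ 2.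
  by rewrite mod2_T// /mod2 ripJJ -/(sq w) ripJl ripxJ oppr0 expr0n add0r.
rewrite /mod2 rip_T// ripJl ripxJ oppr0 expr0n add0r => /eqP.
rewrite eqf_sqr => /orP[]/eqP h; [left|right]; apply/eqP; rewrite -subr_eq0; apply/eqP/sq_eq0.
  by rewrite sqB h sqJ !sq_T// sqJ; ring.
by rewrite opprK sqD h sqJ !sq_T// sqJ; ring.
Qed.

(** The two possibilities of [T_J_sign] define two additive subgroups of [W], the
    union of which is [W]; as a group is not the union of two proper subgroups, one
    of them is [W]. *)
Lemma T_J : exists2 s, s = 1 \/ s = - 1 & forall w, W w -> T (J w) = rscale s (J (T w)).
Proof.
have [h|/existsNP[w /not_implyP[Ww nw]]] := pselect (forall w, W w -> T (J w) = J (T w)).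
  by exists 1; [left|move=> w Ww; rewrite rscale1 h].
exists (- 1); first by right.
move=> z Wz; rewrite rscaleN rscale1; apply: contrapT => nz.
have hw : T (J w) = - J (T w) by case: (T_J_sign Ww) => // /nw.
have hz : T (J z) = J (T z) by case: (T_J_sign Wz) => // /nz.
have := T_J_sign (W_add Ww Wz).
have -> : T (J (w + z)) = - J (T w) + J (T z).
  by rewrite JD (T_add (W_J Ww) (W_J Wz)) hw hz.
rewrite (T_add Ww Wz) (JD (T w) (T z)); case.
  by move=> /addIr h; apply: nw; rewrite hw h.
by rewrite (opprD (J (T w))) => /addrI h; apply: nz; rewrite hz.
Qed.

Lemma wigner : exists U s, semiunitary U s /\ forall x, exists k, U x = k *: f x.
Proof.
have [s hs sJ] := T_J.
have ss : s * s = 1 by case: hs => ->; rewrite ?mulr1 ?mulrNN ?mulr1.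
pose D x := x - inner x e *: e.
pose U x := rscale (rip x e) e' + rscale (s * rip x (J e)) (J e') + T (D x).
have WDx x : W (D x) by rewrite /W /= /D linearBl /= linearZl_LR /= inner_sq e1 mulr1 subrr.
have De x : x = rscale (rip x e) e + rscale (rip x (J e)) (J e) + D x.
  by rewrite /D innerE scaleE /= addrC subrK.
have ripU x y : rip (U x) (U y) = rip x y.
  rewrite [in RHS](De x) [in RHS](De y) /U.
  rewrite (rip_decomp _ _ _ _ sq_e' (T_orth (WDx x)) (T_orth (WDx y))).
  rewrite (rip_decomp _ _ _ _ e1 (WDx x) (WDx y)) (rip_T (WDx x) (WDx y)).
  by rewrite mulrACA ss mul1r.
have UJ x : U (J x) = rscale s (J (U x)).
  have DJ : D (J x) = J (D x) by rewrite /D /J linearZl_LR /= scalerBr !scalerA.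
  by rewrite /U J_decomp// DJ sJ// ripJl ripJJ.
have Ulin a x y : U (rscale a x + y) = rscale a (U x) + U y.
  by apply: (@isometry_linear U setT).
have Uray x : exists k, U x = k *: f x.
  have [x0|x0] := eqVneq (inner x e) 0.
    have Wx : W x by [].
    have [k hk] := T_ray Wx; exists k; rewrite -hk /U.
    have [-> -> _ _] := orthE Wx.
    by rewrite mulr0 !rscale0l !add0r /D x0 scale0r subr0.
  pose y := (inner x e)^-1 *: x.
  have xy : x = inner x e *: y by rewrite /y scalerA mulfV// scale1r.
  have iy : inner y e = 1 by rewrite /y linearZl_LR /= mulVf.
  have Wy : W (D y) by [].
  have ey : e + D y = y by rewrite /D iy scale1r addrC subrK.
  have Uy : U y = (inner (f y) e')^-1 *: f y.
    have /esym := g_T (D y); rewrite ey /g => <-.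
    rewrite /U; move: iy; rewrite innerE => -[-> ->].
    by rewrite mulr0 rscale0l addr0 rscale1.
  have [k1 U1] : exists k1, U x = k1 *: U y.
    rewrite xy scaleE; set p := complex.Re _; set q := complex.Im _.
    exists (p +i* (s * q))%C; rewrite Ulin.
    have -> : rscale q (J y) = rscale q (J y) + 0 by rewrite addr0.
    have U0 : U 0 = 0 by apply: sq_eq0; rewrite /sq ripU rip0l.
    by rewrite Ulin U0 addr0 UJ rscaleA mulrC [in RHS]scaleE.
  have [k2 f2] : exists k2, f y = k2 *: f x.
    apply: cauchy_schwarz_eq; last first.
      move=> f0; move: x0; suff -> : x = 0 by rewrite linear0l eqxx.
      by apply: sq_eq0; rewrite -sq_ray f0 sq0.
    by rewrite fm !sq_ray /y mod2Zr sqZc mod2xx -/(abs2 _); ring.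
  by exists (k1 * ((inner (f y) e')^-1 * k2)); rewrite U1 Uy f2 !scalerA mulrA.
exists U, s; split=> //; split=> // y.
have [x [k ->]] := fs y; have [l Ul] := Uray x.
have [l0|l0] := eqVneq l 0.
  exists 0; have x0 : x = 0 by apply: sq_eq0; rewrite /sq -ripU Ul l0 scale0r rip0l.
  have -> : f x = 0 by apply: sq_eq0; rewrite sq_ray x0 sq0.
  by rewrite scaler0; apply/esym/sq_eq0; rewrite /sq ripU rip0l.
pose c := k * l^-1.
have -> : k *: f x = c *: U x by rewrite Ul /c scalerA mulfVK.
exists (rscale (complex.Re c) x + (rscale (s * complex.Im c) (J x) + 0)).
have U0 : U 0 = 0 by apply: sq_eq0; rewrite /sq ripU rip0l.
rewrite Ulin Ulin U0 addr0 UJ rscaleA [LHS]scaleE; congr (_ + rscale _ _).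
by rewrite mulrAC ss mul1r.
Qed.
End RayMap.
End Wigner.

(** * Conjugation by a unitary or antiunitary map *)
Section SemiunitaryTheory.
Context {R : realType} {H : hilbertType R}.
Implicit Types (x y z : H) (A : H -> H).
Variables (U : H -> H) (s : R).
Hypothesis sU : semiunitary U s.
Let ripU := su_rip sU.
Let ss : s * s = 1.
Proof. by case: (su_sign sU) => ->; rewrite ?mulr1 ?mulrNN ?mulr1. Qed.

Lemma su_lin a x y : U (rscale a x + y) = rscale a (U x) + U y.
Proof. by apply: (@isometry_linear R H U setT). Qed.
Lemma su_sq x : sq (U x) = sq x. Proof. exact: ripU. Qed.
Lemma su_mod2 x y : mod2 (U x) (U y) = mod2 x y.
Proof.
have := ripU x (J y); rewrite /mod2 (su_J sU) ripZr ripU => <-.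
by rewrite exprMn [s ^+ 2]expr2 ss mul1r.
Qed.
Lemma su_inj : injective U.
Proof.
move=> x y xy; apply/eqP; rewrite -subr_eq0; apply/eqP/sq_eq0.
by rewrite sqB -(su_sq x) -(su_sq y) -(su_rip sU) xy -/(sq (U y)); ring.
Qed.
Lemma su_scale (k : R[i]) x : U (k *: x) = (complex.Re k +i* (s * complex.Im k))%C *: U x.
Proof.
have U0 : U 0 = 0 by apply: sq_eq0; rewrite su_sq sq0.
rewrite scaleE su_lin -[rscale (complex.Im k) (J x)]addr0 su_lin U0 addr0.
by rewrite (su_J sU) rscaleA mulrC [RHS]scaleE.
Qed.
Lemma su_scaleD (k : R[i]) x y :
  U (k *: x + y) = (complex.Re k +i* (s * complex.Im k))%C *: U x + U y.
Proof. by rewrite -[k *: x]rscale1 su_lin rscale1 su_scale. Qed.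
Lemma su_inner x y : inner (U x) (U y) = (complex.Re (inner x y) +i* (s * complex.Im (inner x y)))%C.
Proof.
rewrite !innerE /= ripU; congr (_ +i* _)%C.
by have := ripU x (J y); rewrite (su_J sU) ripZr => <-; rewrite mulrA ss mul1r.
Qed.

Lemma su_unitary : bijective U -> unitary U \/ antiunitary U.
Proof.
move=> bU; case: (su_sign sU) => s1; [left|right]; split=> //.
- move=> k x y; rewrite su_scaleD s1 mul1r.
  by case: k.
- by move=> x y; rewrite su_inner s1 mul1r; case: (inner x y).
- move=> k x y; rewrite su_scaleD s1 mulN1r /=.
  by case: k.
- by move=> x y; rewrite su_inner s1 mulN1r; case: (inner x y).
Qed.

Variable V : H -> H.
Hypothesis UV : cancel V U.

Let ripV x y : rip (V x) y = rip x (U y).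
Proof. by rewrite -ripU UV. Qed.

Lemma su_conj_pos A : pos A -> pos (V \o A \o U).
Proof.
move=> [hA pA]; split; last by move=> x; rewrite /qf /= ripV; exact: pA.
have sym x y : rip ((V \o A \o U) x) y = rip x ((V \o A \o U) y).
  by rewrite /= ripV (herm_sa hA) ripC -ripV ripC.
split=> //.
- by move=> k x y; apply: su_inj; rewrite /= !(UV, su_scaleD) (herm_lin hA).
- have [m m0 bA] := herm_bd hA; exists m => // x.
  by rewrite /= -su_sq UV -(su_sq x).
Qed.

Lemma su_conj_qf A x : qf (V \o A \o U) x = qf A (U x).
Proof. by rewrite /qf /= ripV. Qed.

Lemma su_conj_cptf A : cptf A -> cptf (V \o A \o U).
Proof.
move=> kA e e0; have [F hF] := kA e e0; exists (map V F) => x.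
rewrite su_conj_qf; apply: le_trans (hF _) _; rewrite su_sq big_map lerD2l.
by apply: ler_sum => i _; rewrite (ripC x) ripV ripC.
Qed.

Lemma su_conj_rkle A x m : rkle x (V \o A \o U) m <-> rkle (U x) A m.
Proof.
split=> h y; last by rewrite su_conj_qf -su_mod2 -(su_sq y); exact: h.
by rewrite -(UV y) su_mod2 su_sq -su_conj_qf; exact: h.
Qed.
End SemiunitaryTheory.

(** * Isometries of the set of states *)
Section Main.
Context {R : realType} {H : hilbertType R}.

Lemma rk_scale (v : H) (k : R[i]) : sq v = 1 -> sq (k *: v) = 1 -> rk (k *: v) = rk v.
Proof.
move=> v1; rewrite sqZc v1 mulr1 -/(abs2 k) => nk; apply/funext => y.
rewrite /rk linearZr_LR /= scalerA; congr (_ *: _).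
by rewrite mulrC mulrA -normCK -abs2E nk mul1r.
Qed.

Variable phi : (H -> H) -> (H -> H).
Hypothesis phi_bij : set_bij (@states R H) (@states R H) phi.
Hypothesis phi_d1 : forall A B : H -> H, states A -> states B -> d1 (phi A) (phi B) = d1 A B.

Let phiS A : state_op A -> state_op (phi A).
Proof. by move/statesP => sA; apply/statesP; case: phi_bij => h _ _; exact: h. Qed.
Let phi_inj A B : state_op A -> state_op B -> phi A = phi B -> A = B.
Proof.
by move=> /statesP sA /statesP sB; case: phi_bij => _ h _; apply: h; exact: mem_set.
Qed.
Let phi_surj B : state_op B -> exists2 A, state_op A & phi A = B.
Proof.
by move=> /statesP sB; case: phi_bij => _ _ /(_ _ sB)[A sA <-]; exists A => //; exact/statesP.
Qed.
Let phi_iso A B : state_op A -> state_op B -> d1 (phi A) (phi B) = d1 A B.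
Proof. by move=> /statesP sA /statesP sB; exact: phi_d1. Qed.

Lemma phi_pure x : sq x = 1 -> exists2 y, sq y = 1 & phi (rk x) = rk y.
Proof.
move=> x1; have sx := rk_state x1.
apply: metric_pure_rk; first exact: phiS.
move=> C sC hC; have [C' sC' eC] := phi_surj sC.
rewrite -eC; congr phi; apply: rk_metric_pure => // B sB dB.
by rewrite -phi_iso// eC; apply: hC; [exact: phiS|rewrite phi_iso].
Qed.

Lemma phi_pure_surj y : sq y = 1 -> exists2 x, sq x = 1 & phi (rk x) = rk y.
Proof.
move=> y1; have sy := rk_state y1; have [A sA eA] := phi_surj sy.
have [x x1 Ax] : exists2 x, sq x = 1 & A = rk x.
  apply: metric_pure_rk => // C sC hC; apply: phi_inj => //.
  rewrite eA; apply: rk_metric_pure => //; first exact: phiS.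
  move=> B sB; have [B' sB' <-] := phi_surj sB.
  by rewrite -eA !phi_iso//; exact: hC.
by exists x => //; rewrite -Ax.
Qed.

(** A choice of unit vectors [r x] with [phi (rk x) = rk (r x)] extends
    homogeneously to a map [f] of all vectors, to which Wigner's theorem applies. *)
Lemma isometry_semiunitary (e : H) : sq e = 1 -> exists (U : H -> H) s, semiunitary U s /\
  forall x, sq x = 1 -> phi (rk x) = rk (U x).
Proof.
move=> e1.
have /choice[r hr] : forall x : H, exists y : H, sq x = 1 -> sq y = 1 /\ phi (rk x) = rk y.
  move=> x; have [/phi_pure[y y1 h]|nx] := pselect (sq x = 1); first by exists y.
  by exists 0 => /nx.
pose N (x : H) := rscale (Num.sqrt (sq x))^-1 x.
pose f x := rscale (Num.sqrt (sq x)) (r (N x)).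
have N1 x : sq x != 0 -> sq (N x) = 1 by exact: sq_normalize.
have fN x : sq x = 1 -> f x = r x.
  by move=> x1; rewrite /f /N x1 sqrtr1 invr1 !rscale1.
have rsc a b (x y : H) : mod2 (rscale a x) (rscale b y) = a ^+ 2 * b ^+ 2 * mod2 x y.
  by rewrite /rscale mod2Zl mod2Zr /abs2 /=; ring.
have rm x y : sq x = 1 -> sq y = 1 -> mod2 (r x) (r y) = mod2 x y.
  move=> x1 y1; have [rx ex] := hr _ x1; have [ry ey] := hr _ y1.
  apply: d1_rk_mod2 => //; rewrite -ex -ey phi_iso//; exact: rk_state.
have fm x y : mod2 (f x) (f y) = mod2 x y.
  have [x0|x0] := eqVneq (sq x) 0.
    by rewrite /f x0 sqrtr0 rscale0l (sq_eq0 x0) /mod2 !rip0l.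
  have [y0|y0] := eqVneq (sq y) 0.
    by rewrite /f y0 sqrtr0 rscale0l (sq_eq0 y0) mod2C [RHS]mod2C /mod2 !rip0l.
  rewrite /f rsc !sqr_sqrtr ?sq_ge0// rm ?N1// /N rsc !exprVn !sqr_sqrtr ?sq_ge0//.
  by field; rewrite ?x0 ?y0.
have fs y : exists x (k : R[i]), y = k *: f x.
  have [y0|y0] := eqVneq (sq y) 0.
    by exists 0, 0; rewrite scale0r (sq_eq0 y0).
  have [u u1 hu] := phi_pure_surj (N1 _ y0).
  have [ru1 eu] := hr _ u1.
  exists u, ((Num.sqrt (sq y))%:C%C * inner (N y) (r u)).
  rewrite fN// -scalerA -/(rscale _ _).
  have -> : inner (N y) (r u) *: r u = rk (r u) (N y) by [].
  rewrite -eu hu /rk inner_sq N1// scale1r /N rscaleA mulfV ?rscale1//.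
  by rewrite sqrtr_eq0 -ltNge lt_neqAle eq_sym y0 sq_ge0.
have [U [s [sU hU]]] := wigner e1 fm fs.
exists U, s; split=> // x x1; have [k Uk] := hU x; have [rx ->] := hr _ x1.
by rewrite Uk fN// rk_scale// -fN// -Uk (su_sq sU).
Qed.
End Main.

Theorem theorem4 (R : realType) (H : hilbertType R)
    (phi : (H -> H) -> (H -> H))
    (phi_bij : set_bij (@states R H) (@states R H) phi)
    (phi_d1 : forall A B : H -> H, states A -> states B ->
       d1 (phi A) (phi B) = d1 A B) :
  exists U Ustar : H -> H,
    [/\ unitary U \/ antiunitary U, cancel U Ustar, cancel Ustar U &
        forall A : H -> H, states A -> phi A = U \o A \o Ustar].
Proof.
have [[e e1]|noe] := pselect (exists e : H, sq e = 1); last first.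
  have H0 (x : H) : x = 0.
    apply: sq_eq0; apply/eqP; apply: contrapT => /negP x0.
    by apply: noe; exists (rscale (Num.sqrt (sq x))^-1 x); exact: sq_normalize.
  exists id, id; split=> //; first by left; split=> //; exists id.
  by move=> A _; apply/funext => x; rewrite [LHS]H0 [RHS]H0.
have [U [s [sU hU]]] := isometry_semiunitary phi_bij phi_d1 e1.
have /choice[V UV'] := su_surj sU.
have UV : cancel V U by move=> y; rewrite -UV'.
have VU : cancel U V by move=> x; apply: (su_inj sU); rewrite UV.
exists U, V; split=> //; first by apply: (su_unitary sU); exists V.
move=> A sA'; have sA := (statesP A).1 sA'.
have sP : state_op (phi A) by apply/statesP; case: phi_bij => h _ _; exact: h.
suff AE : A = V \o phi A \o U.
  by apply/funext => x; rewrite [in RHS]AE /= !UV.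
have [pA kA tA] := sA; have [pP kP tP] := sP.
apply: rkle_determines => //.
- by move=> x; exact: state_le1.
- exact: (su_conj_pos sU).
- exact: (su_conj_cptf sU).
- by move=> x; rewrite (su_conj_qf sU)// -(su_sq sU x); exact: state_le1.
move=> x m x1 m0.
have Ux : sq (U x) = 1 by rewrite (su_sq sU).
have sx : states (rk x) by apply/statesP; exact: rk_state.
have dd : d1 (rk x) A = d1 (rk (U x)) (phi A) by rewrite -hU// phi_d1.
have h1 := d1_rk_eq x1 Ux sA sP dd m0.
have h2 := su_conj_rkle sU UV (phi A) x m.
by split=> [/h1/h2|/h2/h1].
Qed.
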